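(* Let $G$ be a compact Lie group with Lie algebra $\mathfrak{g}$ and bi-invariant metric $Q$. Suppose $\mathcal{B}=\{e_i\}$ is a $Q$-orthonormal basis for $\mathfrak{g}$. Then $\mathcal{B}$ is stably Ricci-diagonal for left-invariant metrics on $G$ if and only if $\mathcal{B}$ is a nice basis.
   Context: A left-invariant metric on $G$ is diagonal (with respect to $\mathcal{B}$) if distinct elements of $\mathcal{B}$ are orthogonal for the induced inner product on $\mathfrak{g}\cong T_eG$. The basis $\mathcal{B}$ of $\mathfrak{g}$ is stably Ricci-diagonal if for every diagonal left-invariant metric $\mathrm{g}$ on $G$, the Ricci tensor is diagonal as well, i.e. $\mathrm{Ric}_{\mathrm{g}}(e_i,e_j)=0$ at the identity for all $i\neq j$. The basis $\mathcal{B}$ is nice if for all $i,j$ the bracket $[e_i,e_j]$ is a scalar multiple (possibly zero) of some element of $\mathcal{B}$. A bi-invariant metric $Q$ is identified with an $\mathrm{Ad}(G)$-invariant inner product on $\mathfrak{g}$. *)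

(* Defs.v *)
From HB Require Import structures.
From mathcomp Require Import all_boot all_order all_algebra.
From mathcomp Require Import all_classical all_reals all_analysis.

Set Implicit Arguments.
Unset Strict Implicit.
Unset Printing Implicit Defensive.

Import Order.TTheory GRing.Theory Num.Theory numFieldNormedType.Exports.

Local Open Scope classical_set_scope.
Local Open Scope ring_scope.

HB.mixin Record Group_isTopological G of Group G & Topological G := {
  mulg_continuous : continuous (fun z : G * G => (z.1 * z.2)%g);
  invg_continuous : continuous (fun x : G => x^-1%g)
}.

#[short(type="topologicalGroupType")]
HB.structure Definition TopologicalGroup :=
  {G of Group G & Topological G & Group_isTopological G}.

Section Smoothness.
Variables (R : realType) (V W : normedModType R).

(* In finite dimension this is the usual class C^k on the open set U: total
   differentiability at every stage is implied by continuity of the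
   directional derivatives at the next one. *)
Fixpoint Ck (k : nat) (U : set V) (f : V -> W) : Prop :=
  if k is k'.+1 then
    (forall x, U x -> differentiable f x) /\
    (forall v : V, Ck k' U (fun x => 'D_v f x))
  else {in U, continuous f}.

Definition smooth_on (U : set V) (f : V -> W) : Prop := forall k, Ck k U f.

End Smoothness.

Record chart (R : realType) (n : nat) (M : topologicalType) := Chart {
  dom : set M;
  cod : set 'rV[R]_n;
  fwd : M -> 'rV[R]_n;
  bwd : 'rV[R]_n -> M;
  open_dom : open dom;
  open_cod : open cod;
  fwd_cod : forall p, dom p -> cod (fwd p);
  bwd_dom : forall x, cod x -> dom (bwd x);
  fwdK : forall p, dom p -> bwd (fwd p) = p;
  bwdK : forall x, cod x -> fwd (bwd x) = x;
  fwd_continuous : {in dom, continuous fwd};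
  bwd_continuous : {in cod, continuous bwd}
}.

Record smooth_structure (R : realType) (n : nat) (M : topologicalType) :=
  SmoothStructure {
  atlas : set (chart R n M);
  atlas_cover : forall p, exists2 c, atlas c & dom c p;
  atlas_compatible : forall a b, atlas a -> atlas b ->
    smooth_on (cod a `&` bwd a @^-1` dom b) (fwd b \o bwd a);
  hausdorff : hausdorff_space M;
  countable_basis : @second_countable M
}.

(* The model space of G x G is 'rV_n x 'rV_n, with the products of charts of
   G as charts. *)
Record lie_group (R : realType) (n : nat) (G : topologicalGroupType) :=
  LieGroup {
  lie_smooth :> smooth_structure R n G;
  mul_smooth : forall a b c, atlas lie_smooth a -> atlas lie_smooth b ->
    atlas lie_smooth c ->
    smooth_on
      [set z : 'rV[R]_n * 'rV[R]_n |
         [/\ cod a z.1, cod b z.2 & dom c (bwd a z.1 * bwd b z.2)%g]]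
      (fun z => fwd c (bwd a z.1 * bwd b z.2)%g);
  inv_smooth : forall a b, atlas lie_smooth a -> atlas lie_smooth b ->
    smooth_on (cod a `&` [set x | dom b (bwd a x)^-1%g])
              (fun x => fwd b (bwd a x)^-1%g)
}.

Section Manifold.
Variables (R : realType) (n : nat) (M : topologicalType).
Variable S : smooth_structure R n M.

Definition smooth_fun (f : M -> R) : Prop :=
  forall c, atlas S c -> smooth_on (cod c) (f \o bwd c).

(* A tangent vector at p is a directional derivative in a chart around p,
   acting on C^oo(M).  It is encoded as an operator on all functions M -> R,
   extended by zero to the functions that are not smooth, so that equality of
   tangent vectors is equality of operators. *)
Definition tangent (p : M) (v : (M -> R) -> R) : Prop :=
  (forall f, ~ smooth_fun f -> v f = 0) /\
  exists c, [/\ atlas S c, dom c p &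
    exists w : 'rV[R]_n, forall f, smooth_fun f ->
      v f = 'D_w (f \o bwd c) (fwd c p)].

Definition field := M -> (M -> R) -> R.

Definition vector_field (X : field) : Prop :=
  (forall p, tangent p (X p)) /\
  (forall f, smooth_fun f -> smooth_fun (X ^~ f)).

Definition fscale (f : M -> R) (X : field) : field := fun p => f p *: X p.

Definition bracket (X Y : field) : field :=
  fun p f => X p (Y ^~ f) - Y p (X ^~ f).

Definition metric := M -> ((M -> R) -> R) -> ((M -> R) -> R) -> R.

Definition inner (m : metric) (X Y : field) : M -> R :=
  fun p => m p (X p) (Y p).

(* Nothing is required of m p outside of the tangent space at p. *)
Record riemannian (m : metric) : Prop := {
  metric_sym : forall p v w, tangent p v -> tangent p w ->
    m p v w = m p w v;
  metric_linear : forall p (a : R) u v w,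
    tangent p u -> tangent p v -> tangent p w ->
    m p (a *: u + v) w = a * m p u w + m p v w;
  metric_posdef : forall p v, tangent p v -> v != 0 -> 0 < m p v v;
  metric_smooth : forall X Y, vector_field X -> vector_field Y ->
    smooth_fun (inner m X Y)
}.

(* The conditions characterize nabla uniquely on vector fields. *)
Record levi_civita (m : metric) (nabla : field -> field -> field) : Prop := {
  nabla_field : forall X Y, vector_field X -> vector_field Y ->
    vector_field (nabla X Y);
  nabla_addl : forall X X' Y,
    vector_field X -> vector_field X' -> vector_field Y ->
    nabla (X + X') Y = nabla X Y + nabla X' Y;
  nabla_scalel : forall f X Y,
    smooth_fun f -> vector_field X -> vector_field Y ->
    nabla (fscale f X) Y = fscale f (nabla X Y);
  nabla_addr : forall X Y Y',
    vector_field X -> vector_field Y -> vector_field Y' ->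
    nabla X (Y + Y') = nabla X Y + nabla X Y';
  nabla_leibniz : forall f X Y,
    smooth_fun f -> vector_field X -> vector_field Y ->
    nabla X (fscale f Y) = fscale (X ^~ f) Y + fscale f (nabla X Y);
  nabla_torsion_free : forall X Y, vector_field X -> vector_field Y ->
    nabla X Y - nabla Y X = bracket X Y;
  nabla_metric : forall X Y Z,
    vector_field X -> vector_field Y -> vector_field Z ->
    X ^~ (inner m Y Z) = inner m (nabla X Y) Z + inner m Y (nabla X Z)
}.

Definition curvature (nabla : field -> field -> field) (X Y Z : field)
    : field :=
  nabla X (nabla Y Z) - nabla Y (nabla X Z) - nabla (bracket X Y) Z.

Definition orthonormal_at (m : metric) (p : M) (E : 'I_n -> field) : Prop :=
  forall k l, inner m (E k) (E l) p = (k == l)%:R.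

(* The trace at p of X |-> curvature nabla X Y Z, computed in an arbitrary
   family E of vector fields that is m-orthonormal at p; n is the dimension of
   M, so E gives a basis of the tangent space at p. *)
Definition ricci (m : metric) (nabla : field -> field -> field)
    (E : 'I_n -> field) (Y Z : field) (p : M) : R :=
  \sum_(k < n) inner m (curvature nabla (E k) Y Z) (E k) p.

End Manifold.

Section Lie.
Variables (R : realType) (n : nat) (G : topologicalGroupType).
Variable L : lie_group R n G.

Definition push (phi : G -> G) (v : (G -> R) -> R) : (G -> R) -> R :=
  fun f => v (f \o phi).

(* The Lie algebra of G, with Lie bracket given by [bracket]; it is identified
   with the tangent space at 1 by X |-> X 1. *)
Definition lie_algebra (X : field R G) : Prop :=
  vector_field L X /\
  forall g p : G, push (fun x => g * x)%g (X p) = X (g * p)%g.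

Definition left_invariant (m : metric R G) : Prop :=
  forall (g p : G) v w, tangent L p v -> tangent L p w ->
    m (g * p)%g (push (fun x => g * x)%g v) (push (fun x => g * x)%g w)
    = m p v w.

Definition right_invariant (m : metric R G) : Prop :=
  forall (g p : G) v w, tangent L p v -> tangent L p w ->
    m (p * g)%g (push (fun x => x * g)%g v) (push (fun x => x * g)%g w)
    = m p v w.

Definition bi_invariant (m : metric R G) : Prop :=
  left_invariant m /\ right_invariant m.

Definition lie_basis (e : 'I_n -> field R G) : Prop :=
  (forall i, lie_algebra (e i)) /\
  (forall X, lie_algebra X ->
     exists! c : 'I_n -> R, X = \sum_(i < n) c i *: e i).

Definition diagonal (m : metric R G) (e : 'I_n -> field R G) : Prop :=
  forall i j, i != j -> inner m (e i) (e j) 1%g = 0.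

Definition ricci_diagonal (m : metric R G) (e : 'I_n -> field R G) : Prop :=
  forall nabla (E : 'I_n -> field R G), levi_civita L m nabla ->
    (forall k, vector_field L (E k)) -> orthonormal_at m 1%g E ->
    forall i j, i != j -> ricci m nabla E (e i) (e j) 1%g = 0.

Definition stably_ricci_diagonal (e : 'I_n -> field R G) : Prop :=
  forall m, riemannian L m -> left_invariant m -> diagonal m e ->
    ricci_diagonal m e.

Definition nice (e : 'I_n -> field R G) : Prop :=
  forall i j, exists (k : 'I_n) (a : R), bracket (e i) (e j) = a *: e k.

End Lie.

(* Main.v *)
Require Import Defs.
From mathcomp Require Import all_boot all_order all_algebra.
From mathcomp Require Import all_classical all_reals all_analysis.
From mathcomp Require Import ring lra.

Set Implicit Arguments.
Unset Strict Implicit.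
Unset Printing Implicit Defensive.

Import Order.TTheory GRing.Theory Num.Theory numFieldNormedType.Exports.

(** Let c i j k be the structure constants of the basis e. Since Q is
    bi-invariant and e is Q-orthonormal, c is totally skew-symmetric
    ([struct_cstC], [struct_cst_skew]). If a left-invariant metric is diagonal
    in e, with m (e i) (e i) = x i, then Koszul's formula gives
      nabla_(e i) (e j) = sum_k c i j k (x k - x i + x j) / (2 x k) e k
    ([nabla_frame]), and for all i and j ([ricci_frame], [ricci_coef])
      4 Ric (e i, e j) = sum_(k, l) c i k l c j k l
                           (x i x j - (x k - x l)^2) / (x k x l).
    By the symmetries of c, the basis is nice exactly when c i k l c j k l = 0
    for all k, l and all i != j ([niceP]), so a nice basis is stably
    Ricci-diagonal. Conversely, let i != j and suppose that the sum vanishes for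
    all positive x. The weights c i k l c j k l vanish when k or l is i, so
    doubling x i only changes the term x i x j, and subtraction gives
    sum_(k, l) c i k l c j k l y_k y_l = 0 for all positive y, with y = 1 / x.
    A quadratic form that vanishes on the positive cone is zero
    ([quadratic_form_eq0]).

    Everything else derives these formulas from the definitions on G, by three
    devices.

    The n fields e i are Q-orthonormal at every point, and a tangent space has
    dimension at most n, so they span it ([orthonormal_expansion]): every vector
    field is a combination of the e i whose coefficients Q (X, e i) are smooth.
    Tensoriality of the curvature ([ricci_frame]), and the construction of the
    Levi-Civita connection of a diagonal metric ([diag_connection_levi_civita]),
    thus become computations with these global coefficients.

    Right-invariance of Q is a statement about finite translations, and the
    skew-symmetry of ad is its derivative. To differentiate, e j is written in
    the frame of right-invariant fields; the coefficients are the entries of Ad,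
    an orthogonal matrix, and because left- and right-invariant fields commute
    ([invariant_fields_commute]) their derivatives at the identity are the
    structure constants.

    That commutation is the symmetry of second derivatives of
    (x, y) |-> f (x * y), proved in [mixed_derivatives] from the mean value
    theorem. *)

(** * Directional derivatives *)
Section Differentiability.
Local Open Scope classical_set_scope.
Local Open Scope ring_scope.
Context {R : realType}.

Lemma near_eq_differentiable (V W : normedModType R) (f g : V -> W) (x : V) :
  (\near x, f x = g x) -> differentiable f x -> differentiable g x.
Proof.
move=> fg df; have fgx : f x = g x by exact: nbhs_singleton fg.
have dg : g \o shift x = cst (g x) + 'd f x +o_ 0 id.
  apply/eqaddoP => e e0; have /eqaddoP/(_ e e0) := diff_locally df.
  apply: filter_app; move: fg; rewrite (near_shift 0 x) /=.
  apply: filter_app; near=> h; rewrite /= subr0 => fgh.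
  by rewrite !fctE /= fgh fgx.
have := diff_unique (diff_continuous df) dg => e.
by apply/diff_locallyP; rewrite e; split=> //; exact: diff_continuous.
Unshelve. all: by end_near. Qed.

Lemma derive_comp_diff (U V W : normedModType R) (h : U -> V) (f : V -> W) x v :
  differentiable h x -> differentiable f (h x) ->
  'D_v (f \o h) x = 'd f (h x) ('D_v h x).
Proof.
move=> dh df; rewrite !deriveE //; last exact: differentiable_comp.
by rewrite diff_comp.
Qed.

Lemma derive_row_comp n (U : normedModType R) (h : U -> 'rV[R]_n)
    (f : 'rV[R]_n -> R) x v :
  differentiable h x -> differentiable f (h x) ->
  'D_v (f \o h) x = \sum_(i < n) 'D_(delta_mx 0 i) f (h x) * 'D_v h x 0 i.
Proof.
move=> dh df; rewrite derive_comp_diff// [in LHS](row_sum_delta ('D_v h x)).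
rewrite linear_sum; apply: eq_bigr => i _.
by rewrite linearZ -deriveE // [RHS]mulrC.
Qed.

Lemma derive_coord n (U : normedModType R) (h : U -> 'rV[R]_n) x v i :
  differentiable h x -> 'D_v (fun y => h y 0 i) x = 'D_v h x 0 i.
Proof. by move=> dh; rewrite (derive_mx (diff_derivable dh)) mxE. Qed.

Lemma differentiable_row_coord n (U : normedModType R) (h : U -> 'rV[R]_n) x i :
  differentiable h x -> differentiable (fun y => h y 0 i) x.
Proof.
by move=> dh; exact: (differentiable_comp dh (differentiable_coord (h x) 0 i)).
Qed.

Lemma derive_affine (U V W : normedModType R) (A A0 : U -> V) (f : V -> W) x v :
  (forall h, A (h *: v + x) = h *: A0 v + A x) ->
  'D_v (f \o A) x = 'D_(A0 v) f (A x).
Proof. by move=> AE; rewrite /derive /=; under eq_fun do rewrite AE. Qed.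

End Differentiability.

(** * Functions of class C^k *)
Section CkTheory.
Local Open Scope classical_set_scope.
Local Open Scope ring_scope.
Context {R : realType}.

Lemma Ck_diff (V W : normedModType R) k (U : set V) (f : V -> W) x :
  Ck k.+1 U f -> U x -> differentiable f x.
Proof. by case=> + _; apply. Qed.

(** A directional derivative at x depends only on the values near x, so values
    outside of the open set U do not matter at any order. *)
Lemma Ck_ext (V W : normedModType R) k (U : set V) (f g : V -> W) :
  open U -> (forall x, U x -> f x = g x) -> Ck k U f -> Ck k U g.
Proof.
elim: k f g => [|k IH] f g oU fg /=.
  move=> cf x xU; have Ux := set_mem xU.
  have nfg : \forall y \near x, f y = g y by apply: filterS fg _; exact: open_nbhs_nbhs.
  rewrite /continuous_at -(fg _ Ux).
  exact: cvg_trans (near_eq_cvg nfg) (cf _ xU).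
have nfg x : U x -> \forall y \near x, f y = g y.
  by move=> Ux; apply: filterS fg _; exact: open_nbhs_nbhs.
move=> [df Cf]; split=> [x Ux|v].
  by apply: near_eq_differentiable (df _ Ux); exact: nfg.
by apply: IH (Cf v) => // x Ux; apply: near_eq_derive; exact: nfg.
Qed.

Lemma Ck_local (V W : normedModType R) k (U : set V) (f : V -> W) :
  (forall x, U x -> exists2 U', U' x & Ck k U' f) -> Ck k U f.
Proof.
elim: k f => [|k IH] f /= loc.
  by move=> x /set_mem/loc[U' /mem_set U'x]; apply.
split=> [x /loc[U' U'x [df _]]|v]; first exact: df.
by apply: IH => x /loc[U' U'x [_ Cf]]; exists U'.
Qed.

Lemma CkW (V W : normedModType R) k (U : set V) (f : V -> W) :
  Ck k.+1 U f -> Ck k U f.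
Proof.
elim: k f => [|k IH] f.
  by move=> [df _] x /set_mem Ux; exact/differentiable_continuous/df.
by move=> [df Cf]; split=> // v; apply: IH.
Qed.

Lemma Ck_cst (V W : normedModType R) k (U : set V) (a : W) :
  Ck k U (fun _ : V => a).
Proof.
elim: k a => [|k IH] a /=; first by move=> x _; exact: cst_continuous.
split=> [x _|v]; first exact: differentiable_cst.
have -> : (fun x : V => 'D_v (fun _ : V => a) x) = (fun _ => 0).
  by apply/funext => x; exact: derive_cst.
exact: IH.
Qed.

Lemma CkD (V W : normedModType R) k (U : set V) (f g : V -> W) :
  open U -> Ck k U f -> Ck k U g -> Ck k U (fun x => f x + g x).
Proof.
move=> oU; elim: k f g => [|k IH] f g /=.
  by move=> cf cg x xU; apply: continuousD; [exact: cf|exact: cg].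
move=> [df Cf] [dg Cg]; split=> [x Ux|v].
  by apply: differentiableD; [exact: df|exact: dg].
apply: (Ck_ext oU _ (IH _ _ (Cf v) (Cg v))) => x Ux.
by rewrite deriveD //; apply: diff_derivable; [exact: df|exact: dg].
Qed.

Lemma CkM (V : normedModType R) k (U : set V) (f g : V -> R) :
  open U -> Ck k U f -> Ck k U g -> Ck k U (fun x => f x * g x).
Proof.
move=> oU; elim: k f g => [|k IH] f g.
  by move=> cf cg x xU; apply: continuousM; [exact: cf|exact: cg].
move=> Cf1 Cg1; have [df Cf] := Cf1; have [dg Cg] := Cg1.
split=> [x Ux|v].
  by apply: differentiableM; [exact: df|exact: dg].
have C := CkD oU (IH _ _ (CkW Cf1) (Cg v)) (IH _ _ (CkW Cg1) (Cf v)).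
apply: (Ck_ext oU _ C) => x Ux.
by rewrite deriveM //; apply: diff_derivable; [exact: df|exact: dg].
Qed.

Lemma Ck_sum (V W : normedModType R) k (U : set V) n (f : 'I_n -> V -> W) :
  open U -> (forall i, Ck k U (f i)) -> Ck k U (fun x => \sum_(i < n) f i x).
Proof.
move=> oU; elim: n f => [|n IH] f Cf.
  by under [X in Ck _ _ X]eq_fun do rewrite big_ord0; exact: Ck_cst.
under [X in Ck _ _ X]eq_fun do rewrite big_ord_recr.
by apply: CkD => //; exact: IH.
Qed.

Lemma Ck_coord (V : normedModType R) k (U : set V) n (h : V -> 'rV[R]_n) i :
  open U -> Ck k U h -> Ck k U (fun x => h x 0 i).
Proof.
move=> oU; elim: k h => [|k IH] h /=.
  move=> ch x xU; apply: (@continuous_comp _ _ _ h (fun M : 'rV[R]_n => M 0 i)).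
    exact: ch.
  exact: coord_continuous.
move=> [dh Ch]; split=> [x Ux|v]; first exact/differentiable_row_coord/dh.
apply: (Ck_ext oU _ (IH _ (Ch v))) => x Ux.
by rewrite derive_coord //; exact: dh.
Qed.

(** Chain rule at every order: the first derivatives of the composite are
    sums of products of functions of the same kind. *)
Lemma Ck_comp (V : normedModType R) n k (U : set V) (U' : set 'rV[R]_n)
    (h : V -> 'rV[R]_n) (f : 'rV[R]_n -> R) :
  open U -> (forall x, U x -> U' (h x)) ->
  Ck k U' f -> Ck k U h -> Ck k U (f \o h).
Proof.
move=> oU hU; elim: k f => [|k IH] f.
  move=> cf ch x xU; apply: continuous_comp; first exact: ch.
  by apply: cf; apply/mem_set/hU/set_mem.
move=> Cf1 Ch1; have [df Cf] := Cf1; have [dh Ch] := Ch1.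
split=> [x Ux|v]; first by apply: differentiable_comp; auto.
apply: (Ck_ext (f := fun x =>
  \sum_(i < n) ('D_(delta_mx 0 i) f \o h) x * 'D_v h x 0 i) oU).
  by move=> x Ux; rewrite derive_row_comp; auto.
apply: Ck_sum => // i; apply: CkM => //.
  by apply: IH (CkW Ch1); exact: Cf.
exact/Ck_coord/Ch.
Qed.

(** Composition with an affine map A of linear part A0 turns the derivative
    along A0 v into the derivative along v, so that f may take its arguments in
    any normed space, while [Ck_comp] expands in coordinates of a row space. *)
Lemma Ck_affine (V V' W : normedModType R) k (U : set V) (U' : set V')
    (A A0 : V -> V') (f : V' -> W) :
  (forall x, differentiable A x) ->
  (forall x v h, A (h *: v + x) = h *: A0 v + A x) ->
  (forall x, U x -> U' (A x)) -> Ck k U' f -> Ck k U (f \o A).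
Proof.
move=> dA AE AU; elim: k f => [|k IH] f.
  move=> cf x xU; apply: continuous_comp; first exact: differentiable_continuous.
  by apply: cf; apply/mem_set/AU/set_mem.
move=> [df Cf]; split=> [x Ux|v].
  by apply: differentiable_comp => //; apply: df; exact: AU.
under [X in Ck _ _ X]eq_fun do rewrite (derive_affine (A0 := A0))//.
exact: IH (Cf (A0 v)).
Qed.

End CkTheory.

(** * Symmetry of second derivatives *)
Section Schwarz.
Local Open Scope classical_set_scope.
Local Open Scope ring_scope.
Context {R : realType} {V : normedModType R}.

Lemma differentiable_line (u x : V) (t : R) :
  differentiable (fun s : R => s *: u + x) t.
Proof.
exact: (@differentiableD _ _ _ (fun s : R => s *: u) (fun=> x)).
Qed.

Lemma mean_value_line (f : V -> R) (x u : V) (h : R) : 0 < h ->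
  (forall t : R, 0 <= t <= h -> differentiable f (t *: u + x)) ->
  exists2 t : R, 0 < t < h &
    f (h *: u + x) - f x = h * 'D_u f (t *: u + x).
Proof.
move=> h0 df; pose g (t : R) := f (t *: u + x).
have dg (t : R) : 0 <= t <= h -> differentiable g t.
  move=> th; apply: (differentiable_comp (differentiable_line u x t)).
  exact: df.
have [||t tI] := @MVT R g (fun t => 'D_u f (t *: u + x)) 0 h h0.
- move=> t; rewrite in_itv /= => /andP[t0 th].
  apply: DeriveDef; first by apply: diff_derivable; apply: dg; rewrite !ltW.
  rewrite (derive_affine (A := fun s : R => s *: u + x) (A0 := fun s => s *: u)).
    by rewrite scale1r.
  by move=> s; rewrite scalerDl scalerA addrA.
- apply: continuous_in_subspaceT => t /set_mem; rewrite /= in_itv /= => th.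
  exact/differentiable_continuous/dg.
- rewrite /g scale0r add0r subr0 mulrC => ->.
  by exists t.
Qed.

(** The second difference of f over a parallelogram with sides h u and h v is h^2
    times a second derivative at an interior point: the mean value theorem is
    applied along u to y |-> f (h v + y) - f y, then along v to the derivative of
    f along u. *)
Lemma second_difference (U : set V) (f : V -> R) (x u v : V) (h : R) :
  0 < h -> open U -> Ck 2 U f ->
  (forall s t : R, 0 <= s <= h -> 0 <= t <= h -> U (s *: u + (t *: v + x))) ->
  exists s t : R, [/\ 0 < s < h, 0 < t < h &
    f (h *: u + (h *: v + x)) - f (h *: u + x) - (f (h *: v + x) - f x) =
    h * (h * 'D_v (fun y => 'D_u f y) (s *: u + (t *: v + x)))].
Proof.
move=> h0 oU [df Cf] Uh; have h0' : (0 : R) <= 0 <= h by rewrite lexx ltW.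
have hh' : 0 <= h <= h by rewrite lexx ltW.
have Ushift t : 0 <= t <= h -> U (t *: u + (h *: v + x)) by move=> th; exact: Uh.
have U0 t : 0 <= t <= h -> U (t *: u + x).
  by move=> th; have := Uh t 0 th h0'; rewrite scale0r add0r.
have dsh y : U (h *: v + y) -> differentiable (f \o shift (h *: v)) y.
  move=> Uy; apply: differentiable_comp; last by apply: df; rewrite /= addrC.
  by apply: (@differentiableD _ _ _ id (fun=> h *: v)) => //; exact: differentiable_cst.
have sw y : 'D_u (f \o shift (h *: v)) y = 'D_u f (h *: v + y).
  rewrite (derive_affine (A0 := id)) //= 1?addrC // => k.
  by rewrite -addrA (addrC y).
pose F y := (f \o shift (h *: v)) y - f y.
have [t th|s sh] := @mean_value_line F x u h h0.
  apply: differentiableB; last exact/df/U0.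
  by apply: dsh; rewrite addrCA; exact: Ushift.
rewrite /F /= deriveB; last 2 first.
- apply/diff_derivable/dsh; rewrite addrCA; apply: Ushift; rewrite !ltW //.
  + by case/andP: sh.
  + by case/andP: sh.
- apply/diff_derivable/df/U0; rewrite !ltW //.
  + by case/andP: sh.
  + by case/andP: sh.
rewrite sw => E.
have sh' : 0 <= s <= h by case/andP: sh => ? ?; rewrite !ltW.
have [t th|t th] := @mean_value_line (fun y => 'D_u f y) (s *: u + x) v h h0.
  have [dDf _] := Cf u; apply: dDf; rewrite addrCA; exact: Uh.
move=> E2; exists s, t; split => //.
rewrite [s *: u + (_ + _)]addrCA -E2 -E; congr (f _ - _ - (f _ - _)).
  by rewrite -addrA [x + _]addrC.
by rewrite addrC.
Qed.

(** Used with the two mixed derivatives: a second difference is symmetric in its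
    two sides, but the two mean value arguments give different points y and z. *)
Lemma continuous_eq_limit (A B : V -> R) (a : V) :
  {for a, continuous A} -> {for a, continuous B} ->
  (forall r : R, 0 < r -> exists y z, [/\ ball a r y, ball a r z & A y = B z]) ->
  A a = B a.
Proof.
move=> /cvgrPdist_lt cA /cvgrPdist_lt cB AB.
apply/eqP; rewrite -subr_eq0 -normr_le0; apply/ler_addgt0Pl => e e0.
rewrite addr0; have e2 : 0 < e / 2 by rewrite divr_gt0.
have /nbhs_ballP[r /= r0 rP] :
    nbhs a [set y | `|A a - A y| < e / 2 /\ `|B a - B y| < e / 2].
  exact: filterI (cA _ e2) (cB _ e2).
have [y [z [ya za yz]]] := AB _ r0.
have [dA _] := rP _ ya; have [_ dB] := rP _ za.
rewrite -(subrKA (A y)) (splitr e) (le_trans (ler_normD _ _))// lerD//.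
  exact: ltW.
by rewrite distrC yz ltW.
Qed.

Lemma mixed_derivatives (U : set V) (f : V -> R) (a u v : V) :
  open U -> U a -> Ck 2 U f ->
  'D_v (fun y => 'D_u f y) a = 'D_u (fun y => 'D_v f y) a.
Proof.
move=> oU Ua Cf; have [df Cf'] := Cf.
apply: (@continuous_eq_limit (fun y => 'D_v (fun y => 'D_u f y) y)
                             (fun y => 'D_u (fun y => 'D_v f y) y)).
- by have [_ /(_ v) cA] := Cf' u; apply: cA; exact/mem_set.
- by have [_ /(_ u) cB] := Cf' v; apply: cB; exact/mem_set.
move=> r0 r0_gt0.
have [r rr0 [r_gt0 rU]] : exists2 r, r <= r0 & 0 < r /\ ball a r `<=` U.
  have /nbhs_ballP[r1 /= r1_gt0 r1U] : nbhs a U by apply: open_nbhs_nbhs; split.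
  exists (Num.min r0 r1); first by rewrite ge_min lexx.
  split; first by rewrite lt_min r0_gt0.
  by apply: subset_trans r1U; apply: le_ball; rewrite ge_min lexx orbT.
(* h is so small that h (|u| + |v|) < r; adding 1 avoids a zero denominator. *)
pose h := r / (2 * (`|u| + `|v| + 1)).
have k0 : 0 < `|u| + `|v| + 1 by rewrite ltr_wpDl.
have h0 : 0 < h by rewrite divr_gt0 // mulr_gt0.
have near_a (s t : R) : 0 <= s <= h -> 0 <= t <= h ->
    ball a r (s *: u + (t *: v + a)).
  move=> /andP[s0 sh] /andP[t0 th]; rewrite -ball_normE /=.
  rewrite addrA opprD addrCA subrr addr0 normrN.
  apply: (le_lt_trans (ler_normD _ _)); rewrite !normrZ !ger0_norm//.
  apply: (@le_lt_trans _ _ (h * `|u| + h * `|v|)).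
    by apply: lerD; apply: ler_wpM2r.
  rewrite -mulrDr (@lt_trans _ _ (h * (`|u| + `|v| + 1)))// ?ltr_pM2l ?ltrDl//.
  rewrite /h invfM -!mulrA mulVf ?gt_eqF// mulr1.
  by rewrite gtr_pMr // invf_lt1 // ltr1n.
have near_a' (s t : R) : 0 <= s <= h -> 0 <= t <= h ->
    ball a r (s *: v + (t *: u + a)).
  by move=> sh' th'; rewrite addrCA; exact: near_a.
have W (s : R) : 0 < s < h -> 0 <= s <= h by case/andP => ? ?; rewrite !ltW.
have [s [t [sh th E1]]] := second_difference h0 oU Cf
  (fun (s t : R) sh th => rU _ (near_a s t sh th)).
have [s' [t' [sh' th' E2]]] := second_difference h0 oU Cf
  (fun (s t : R) sh th => rU _ (near_a' s t sh th)).
exists (s *: u + (t *: v + a)), (s' *: v + (t' *: u + a)); split.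
- by apply: (le_ball rr0); apply: near_a; exact: W.
- by apply: (le_ball rr0); apply: near_a'; exact: W.
have hn0 : h != 0 by rewrite gt_eqF.
apply: (mulfI hn0); apply: (mulfI hn0); apply: etrans (esym E1) _.
apply: etrans _ E2; rewrite [h *: v + (_ + _)]addrCA.
by rewrite opprB !opprD !addrA addrAC; ring.
Qed.

End Schwarz.

(** * Smooth functions, tangent vectors and metrics on a manifold *)
Section ManifoldTheory.
Local Open Scope classical_set_scope.
Local Open Scope ring_scope.

Lemma open_preimage_in (T T' : topologicalType) (A : set T) (B : set T')
    (h : T -> T') :
  open A -> open B -> {in A, continuous h} -> open (A `&` h @^-1` B).
Proof.
move=> oA oB ch; rewrite openE => x [Ax Bhx]; apply: filterI.
  exact: open_nbhs_nbhs.
by apply: (ch x (mem_set Ax)); exact: open_nbhs_nbhs.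
Qed.

Context {R : realType} {n : nat} {M : topologicalType}.
Variable S : smooth_structure R n M.
Implicit Types (f g : M -> R) (p : M) (v w : (M -> R) -> R).

Lemma smooth_cst (a : R) : smooth_fun S (fun=> a).
Proof. by move=> c _ k; exact: Ck_cst. Qed.

Lemma smoothD f g : smooth_fun S f -> smooth_fun S g ->
  smooth_fun S (fun p => f p + g p).
Proof.
move=> sf sg c Sc k; apply: (CkD (f := f \o bwd c) (g := g \o bwd c)).
- exact: open_cod.
- exact: sf.
- exact: sg.
Qed.

Lemma smoothM f g : smooth_fun S f -> smooth_fun S g ->
  smooth_fun S (fun p => f p * g p).
Proof.
move=> sf sg c Sc k; apply: (CkM (f := f \o bwd c) (g := g \o bwd c)).
- exact: open_cod.
- exact: sf.
- exact: sg.
Qed.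

Lemma smoothZ (a : R) f : smooth_fun S f -> smooth_fun S (fun p => a * f p).
Proof. by move=> sf; apply: smoothM => //; exact: smooth_cst. Qed.

Lemma smooth_sum m (f : 'I_m -> M -> R) : (forall i, smooth_fun S (f i)) ->
  smooth_fun S (fun p => \sum_(i < m) f i p).
Proof.
move=> sf c Sc k; apply: (Ck_sum (f := fun i => f i \o bwd c) (@open_cod _ _ _ c)).
by move=> i; exact: sf.
Qed.

Lemma smooth_chart_diff f c p : smooth_fun S f -> atlas S c -> dom c p ->
  differentiable (f \o bwd c) (fwd c p).
Proof.
by move=> sf Sc cp; apply: (Ck_diff (sf c Sc 1%N)); exact: fwd_cod.
Qed.

(** Continuity is included because it makes open the sets on which the
    expressions of phi in charts are required to be smooth. *)
Definition smooth_map (phi : M -> M) : Prop :=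
  continuous phi /\ forall a b, atlas S a -> atlas S b ->
    smooth_on (cod a `&` [set x | dom b (phi (bwd a x))])
              (fun x => fwd b (phi (bwd a x))).

Lemma smooth_map_id : smooth_map id.
Proof.
split=> [x|a b Sa Sb]; [exact: cvg_id|exact: (atlas_compatible Sa Sb)].
Qed.

Lemma open_chart_map (phi : M -> M) (a b : chart R n M) : continuous phi ->
  open (cod a `&` [set x | dom b (phi (bwd a x))]).
Proof.
move=> cphi; apply: (open_preimage_in (h := phi \o bwd a)).
- exact: open_cod.
- exact: open_dom.
- move=> x ax; apply: continuous_comp; first exact: bwd_continuous.
  exact: cphi.
Qed.

Lemma smooth_fun_comp (phi : M -> M) f : smooth_map phi -> smooth_fun S f ->
  smooth_fun S (f \o phi).
Proof.
move=> [cphi sphi] sf a Sa k; apply: Ck_local => x ax.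
have [b Sb bx] := atlas_cover S (phi (bwd a x)).
have oU := @open_chart_map phi a b cphi.
exists (cod a `&` [set x | dom b (phi (bwd a x))]) => //.
apply: (Ck_ext (f := (f \o bwd b) \o (fun x => fwd b (phi (bwd a x)))) oU).
  by move=> y [ay by_]; rewrite /= fwdK.
apply: (Ck_comp oU _ (sf b Sb k) (sphi a b Sa Sb k)).
by move=> y [ay by_]; exact: fwd_cod.
Qed.

(** The chain rule in charts. For the identity map it is the change of charts, and
    for a translation the transport of tangent vectors. *)
Lemma push_chart (phi : M -> M) p c c' (w : 'rV[R]_n) :
  smooth_map phi -> atlas S c -> dom c p -> atlas S c' -> dom c' (phi p) ->
  exists w' : 'rV[R]_n, forall f, smooth_fun S f ->
    'D_w ((f \o phi) \o bwd c) (fwd c p) = 'D_w' (f \o bwd c') (fwd c' (phi p)).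
Proof.
move=> [cphi sphi] Sc cp Sc' c'p.
exists ('D_w (fun x => fwd c' (phi (bwd c x))) (fwd c p)) => f sf.
have oU := @open_chart_map phi c c' cphi.
set U := (X in open X) in oU.
have Up : U (fwd c p) by split; [exact: fwd_cod|rewrite /= fwdK].
have dt : differentiable (fun x => fwd c' (phi (bwd c x))) (fwd c p).
  exact: (Ck_diff (sphi _ _ Sc Sc' 1%N)).
have df : differentiable (f \o bwd c') (fwd c' (phi p)) by exact: smooth_chart_diff.
have E : \forall x \near fwd c p, ((f \o phi) \o bwd c) x =
    ((f \o bwd c') \o (fun x => fwd c' (phi (bwd c x)))) x.
  have : \forall x \near fwd c p, U x by exact: open_nbhs_nbhs.
  by apply: filterS => x [cx c'x]; rewrite /= fwdK.
have df' : differentiable (f \o bwd c') ((fun x => fwd c' (phi (bwd c x))) (fwd c p)).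
  by rewrite /= fwdK.
rewrite (near_eq_derive _ E) (derive_comp_diff _ dt df') -(deriveE _ df').
by rewrite /= fwdK.
Qed.

Lemma tangent_chart p v c : tangent S p v -> atlas S c -> dom c p ->
  exists w : 'rV[R]_n, forall f, smooth_fun S f ->
    v f = 'D_w (f \o bwd c) (fwd c p).
Proof.
move=> [_ [c0 [Sc0 c0p [w0 w0P]]]] Sc cp.
have [w wP] := push_chart w0 smooth_map_id Sc0 c0p Sc cp.
by exists w => f sf; rewrite w0P // -wP.
Qed.

(** Tangent vectors vanish on functions that are not smooth, whence the
    condition that composition with phi reflects smoothness; it holds for
    diffeomorphisms. *)
Lemma tangent_push (phi : M -> M) p v : smooth_map phi ->
  (forall f, smooth_fun S (f \o phi) -> smooth_fun S f) ->
  tangent S p v -> tangent S (phi p) (fun f => v (f \o phi)).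
Proof.
move=> sphi phiI [v0 [c [Sc cp [w wP]]]]; split.
  by move=> f nsf; apply: v0 => /phiI.
have [c' Sc' c'p] := atlas_cover S (phi p).
have [w' w'P] := push_chart w sphi Sc cp Sc' c'p.
exists c'; split=> //; exists w' => f sf.
by rewrite wP; [exact: w'P|exact: smooth_fun_comp].
Qed.

Lemma tangent_lin p (a : R) v w : tangent S p v -> tangent S p w ->
  tangent S p (a *: v + w).
Proof.
move=> tv tw; split=> [f nf|].
  by rewrite -[LHS]/(a * v f + w f) (proj1 tv) // (proj1 tw) // mulr0 addr0.
have [c Sc cp] := atlas_cover S p.
have [x xP] := tangent_chart tv Sc cp; have [y yP] := tangent_chart tw Sc cp.
exists c; split=> //; exists (a *: x + y) => f sf.
have df := smooth_chart_diff sf Sc cp.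
by rewrite -[LHS]/(a * v f + w f) xP // yP // !deriveE // linearP.
Qed.

Lemma tangent0 p : tangent S p 0.
Proof.
split=> //; have [c Sc cp] := atlas_cover S p.
by exists c; split=> //; exists 0 => f sf; rewrite derive0.
Qed.

Lemma tangentZ p (a : R) v : tangent S p v -> tangent S p (a *: v).
Proof.
move=> tv; rewrite -[_ *: _]addr0; apply: tangent_lin => //.
exact: tangent0.
Qed.

Lemma tangentD p v w : tangent S p v -> tangent S p w -> tangent S p (v + w).
Proof. by move=> tv tw; rewrite -[v]scale1r; exact: tangent_lin. Qed.

Lemma tangent_sum p m (v : 'I_m -> (M -> R) -> R) :
  (forall i, tangent S p (v i)) -> tangent S p (\sum_i v i).
Proof.
by move=> tv; apply: big_ind => //; [exact: tangent0|exact: tangentD].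
Qed.

Lemma tangent_cst p v (a : R) : tangent S p v -> v (fun=> a) = 0.
Proof.
move=> [_ [c [Sc cp [w ->]]]]; last exact: smooth_cst.
exact: (derive_cst a).
Qed.

Lemma tangent_addf p v f g : tangent S p v -> smooth_fun S f -> smooth_fun S g ->
  v (fun x => f x + g x) = v f + v g.
Proof.
move=> [_ [c [Sc cp [w wP]]]] sf sg; rewrite !wP//; last exact: smoothD.
by apply: (@deriveD _ _ _ (f \o bwd c) (g \o bwd c));
  apply/diff_derivable/smooth_chart_diff.
Qed.

Lemma tangent_mulf p v f g : tangent S p v -> smooth_fun S f -> smooth_fun S g ->
  v (fun x => f x * g x) = v f * g p + f p * v g.
Proof.
move=> [_ [c [Sc cp [w wP]]]] sf sg; rewrite !wP//; last exact: smoothM.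
rewrite (@deriveM _ _ (f \o bwd c) (g \o bwd c)) /=; first last.
- exact/diff_derivable/smooth_chart_diff.
- exact/diff_derivable/smooth_chart_diff.
by rewrite fwdK // addrC; congr (_ + _); rewrite -[_ *: _]/(_ * _) mulrC.
Qed.

Lemma tangent_scalef p v (a : R) f : tangent S p v -> smooth_fun S f ->
  v (fun x => a * f x) = a * v f.
Proof.
move=> tv sf; rewrite (tangent_mulf tv (smooth_cst a) sf).
by rewrite (tangent_cst _ tv) mul0r add0r.
Qed.

Lemma tangent_sumf p v m (f : 'I_m -> M -> R) :
  tangent S p v -> (forall i, smooth_fun S (f i)) ->
  v (fun x => \sum_(i < m) f i x) = \sum_(i < m) v (f i).
Proof.
move=> tv; elim: m f => [|m IH] f sf.
  rewrite big_ord0; under [X in v X]eq_fun do rewrite big_ord0.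
  exact: tangent_cst tv.
rewrite big_ord_recr /=; under [X in v X]eq_fun do rewrite big_ord_recr/=.
by rewrite (tangent_addf tv) // ?IH//; apply: smooth_sum.
Qed.

Section Metric.
Variables (m : metric R M) (rm : riemannian S m) (p : M).

Lemma metricZDl (a : R) u v w : tangent S p u -> tangent S p v -> tangent S p w ->
  m p (a *: u + v) w = a * m p u w + m p v w.
Proof. exact: (metric_linear rm). Qed.

Lemma metric0l w : tangent S p w -> m p 0 w = 0.
Proof.
move=> tw; have := metricZDl 1 (tangent0 p) (tangent0 p) tw.
rewrite scale1r addr0 mul1r -[LHS]addr0 => /addrI.
by move->.
Qed.

Lemma metricZl (a : R) v w : tangent S p v -> tangent S p w ->
  m p (a *: v) w = a * m p v w.
Proof.
move=> tv tw; rewrite -[_ *: _]addr0 metricZDl// ?metric0l ?addr0//.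
exact: tangent0.
Qed.

Lemma metricDl u v w : tangent S p u -> tangent S p v -> tangent S p w ->
  m p (u + v) w = m p u w + m p v w.
Proof. by move=> tu tv tw; rewrite -[u]scale1r metricZDl// scale1r mul1r. Qed.

Lemma metricC v w : tangent S p v -> tangent S p w -> m p v w = m p w v.
Proof. exact: (Defs.metric_sym rm). Qed.

Lemma metric_suml k (v : 'I_k -> (M -> R) -> R) w :
  (forall i, tangent S p (v i)) -> tangent S p w ->
  m p (\sum_i v i) w = \sum_i m p (v i) w.
Proof.
move=> tv tw; elim: k v tv => [|k IH] v tv; first by rewrite !big_ord0 metric0l.
by rewrite !big_ord_recr /= metricDl ?IH//; exact: tangent_sum.
Qed.

Lemma metric_sumZl k (a : 'I_k -> R) (v : 'I_k -> (M -> R) -> R) w :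
  (forall i, tangent S p (v i)) -> tangent S p w ->
  m p (\sum_i a i *: v i) w = \sum_i a i * m p (v i) w.
Proof.
move=> tv tw; rewrite metric_suml// => [|i]; last exact: tangentZ.
by apply: eq_bigr => i _; rewrite metricZl.
Qed.

Lemma metric_sumZr k (a : 'I_k -> R) (v : 'I_k -> (M -> R) -> R) w :
  (forall i, tangent S p (v i)) -> tangent S p w ->
  m p w (\sum_i a i *: v i) = \sum_i a i * m p w (v i).
Proof.
move=> tv tw; rewrite metricC ?metric_sumZl//.
  by apply: eq_bigr => i _; rewrite metricC.
by apply: tangent_sum => i; exact: tangentZ.
Qed.

(** The tangent space is the image of the model space under a linear map, so its
    dimension is at most n, and n orthonormal tangent vectors span it. *)
Lemma orthonormal_expansion (E : 'I_n -> (M -> R) -> R) v :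
  (forall k, tangent S p (E k)) -> (forall k l, m p (E k) (E l) = (k == l)%:R) ->
  tangent S p v -> v = \sum_k m p v (E k) *: E k.
Proof.
move=> tE oE tv; have [c Sc cp] := atlas_cover S p.
have /choice[W WP] : forall k, exists w : 'rV[R]_n, forall f, smooth_fun S f ->
    E k f = 'D_w (f \o bwd c) (fwd c p) by move=> k; exact: tangent_chart.
have [w wP] := tangent_chart tv Sc cp.
pose A := \matrix_k W k.
have comb (u : 'rV[R]_n) f : smooth_fun S f ->
    'D_(u *m A) (f \o bwd c) (fwd c p) = (\sum_k u 0 k *: E k) f.
  move=> sf; have df := smooth_chart_diff sf Sc cp.
  rewrite fct_sumE deriveE // mulmx_sum_row linear_sum; apply: eq_bigr => k _.
  by rewrite linearZ rowK -[(_ *: E k) f]/(_ * E k f) WP// deriveE.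
have zero (u : 'rV[R]_n) f : ~ smooth_fun S f -> (\sum_k u 0 k *: E k) f = 0.
  move=> nf; rewrite fct_sumE big1// => k _.
  by rewrite -[(_ *: E k) f]/(_ * E k f) (proj1 (tE k))// mulr0.
have coord (u : 'rV[R]_n) j : m p (\sum_k u 0 k *: E k) (E j) = u 0 j.
  rewrite metric_sumZl// (bigD1 j)//= oE eqxx mulr1 big1 ?addr0// => k kj.
  by rewrite oE (negbTE kj) mulr0.
(* A linear relation between the rows of A is one between the E k, and these
   are independent because they are orthonormal. *)
have unitA : A \in unitmx.
  rewrite -row_free_unit -kermx_eq0; apply/eqP/row_matrixP => i.
  rewrite row0; set u := row i _.
  have uA : u *m A = 0 by rewrite -row_mul mulmx_ker row0.
  have E0 : \sum_k u 0 k *: E k = 0.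
    apply/funext => f; have [sf|nf] := pselect (smooth_fun S f); last exact: zero.
    by rewrite -comb// uA derive0.
  by apply/rowP => j; rewrite -coord E0 metric0l// mxE.
pose u := w *m invmx A.
have vE : v = \sum_k u 0 k *: E k.
  apply/funext => f; have [sf|nf] := pselect (smooth_fun S f).
    by rewrite -comb// mulmxKV// wP.
  by rewrite zero// (proj1 tv).
rewrite [LHS]vE; apply: eq_bigr => k _.
by rewrite [in RHS]vE coord.
Qed.

End Metric.

End ManifoldTheory.

(** * Translations and invariant fields on a Lie group *)
Section Translations.
Local Open Scope classical_set_scope.
Local Open Scope ring_scope.
Context {R : realType} {n : nat} {G : topologicalGroupType}.
Variable L : lie_group R n G.
Implicit Types (f : G -> R) (p g : G) (v w : (G -> R) -> R).

Definition ltrans g (x : G) : G := (g * x)%g.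
Definition rtrans g (x : G) : G := (x * g)%g.

Lemma ltrans_continuous g : continuous (ltrans g).
Proof.
move=> x; apply: (@continuous_comp _ _ _ (fun x : G => (g, x))
                    (fun z : G * G => (z.1 * z.2)%g)).
  by apply: cvg_pair; [exact: cvg_cst|exact: cvg_id].
exact: mulg_continuous.
Qed.

Lemma rtrans_continuous g : continuous (rtrans g).
Proof.
move=> x; apply: (@continuous_comp _ _ _ (fun x : G => (x, g))
                    (fun z : G * G => (z.1 * z.2)%g)).
  by apply: cvg_pair; [exact: cvg_id|exact: cvg_cst].
exact: mulg_continuous.
Qed.

(** The maps x |-> (x, y0) and y |-> (x0, y) are affine, so that partial
    derivatives are directional derivatives along (v, 0) and (0, v). *)
Lemma slicelE (y0 x v : 'rV[R]_n) (h : R) :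
  (h *: v + x, y0) = h *: (v, 0 : 'rV[R]_n) + (x, y0).
Proof. by congr pair; rewrite /= scaler0 add0r. Qed.

Lemma slicerE (x0 y v : 'rV[R]_n) (h : R) :
  (x0, h *: v + y) = h *: (0 : 'rV[R]_n, v) + (x0, y).
Proof. by congr pair; rewrite /= scaler0 add0r. Qed.

Lemma Ck_slicel (W : normedModType R) k (U : set 'rV[R]_n)
    (U' : set ('rV[R]_n * 'rV[R]_n)) (F : 'rV[R]_n * 'rV[R]_n -> W) y0 :
  (forall x, U x -> U' (x, y0)) -> Ck k U' F -> Ck k U (fun x => F (x, y0)).
Proof.
move=> UU'; apply: (Ck_affine (A := fun x => (x, y0)) (A0 := fun x => (x, 0))) => //.
by move=> x v h; exact: slicelE.
Qed.

Lemma Ck_slicer (W : normedModType R) k (U : set 'rV[R]_n)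
    (U' : set ('rV[R]_n * 'rV[R]_n)) (F : 'rV[R]_n * 'rV[R]_n -> W) x0 :
  (forall y, U y -> U' (x0, y)) -> Ck k U' F -> Ck k U (fun y => F (x0, y)).
Proof.
move=> UU'; apply: (Ck_affine (A := fun y => (x0, y)) (A0 := fun y => (0, y))) => //.
by move=> x v h; exact: slicerE.
Qed.

Lemma derive_slicel (W : normedModType R) (F : 'rV[R]_n * 'rV[R]_n -> W)
    (x y v : 'rV[R]_n) :
  'D_v (fun x => F (x, y)) x = 'D_(v, 0) F (x, y).
Proof.
apply: (derive_affine (A := fun x => (x, y)) (A0 := fun x => (x, 0))) => h.
exact: slicelE.
Qed.

Lemma derive_slicer (W : normedModType R) (F : 'rV[R]_n * 'rV[R]_n -> W)
    (x y v : 'rV[R]_n) :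
  'D_v (fun y => F (x, y)) y = 'D_(0, v) F (x, y).
Proof.
apply: (derive_affine (A := fun y => (x, y)) (A0 := fun y => (0, y))) => h.
exact: slicerE.
Qed.

Lemma ltrans_smooth g : smooth_map L (ltrans g).
Proof.
split=> [|a b La Lb k]; first exact: ltrans_continuous.
have [c Lc cg] := atlas_cover L g.
have := mul_smooth Lc La Lb k; set F := (X in Ck k _ X) => CF.
have -> : (fun x => fwd b (ltrans g (bwd a x))) = (fun x => F (fwd c g, x)).
  by apply/funext => x; rewrite /F /= fwdK.
apply: Ck_slicer CF => x [ax bx]; split=> //=; first exact: fwd_cod.
by rewrite fwdK.
Qed.

Lemma rtrans_smooth g : smooth_map L (rtrans g).
Proof.
split=> [|a b La Lb k]; first exact: rtrans_continuous.
have [c Lc cg] := atlas_cover L g.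
have := mul_smooth La Lc Lb k; set F := (X in Ck k _ X) => CF.
have -> : (fun x => fwd b (rtrans g (bwd a x))) = (fun x => F (x, fwd c g)).
  by apply/funext => x; rewrite /F /= fwdK.
apply: Ck_slicel CF => x [ax bx]; split=> //=; first exact: fwd_cod.
by rewrite fwdK.
Qed.

Lemma rtransK g f : (f \o rtrans g) \o rtrans g^-1%g = f.
Proof. by apply/funext => x; rewrite /= /rtrans -mulgA mulVg mulg1. Qed.

Lemma smooth_rtransE g f : smooth_fun L (f \o rtrans g) -> smooth_fun L f.
Proof.
by move=> sf; rewrite -(rtransK g f); apply: smooth_fun_comp => //; exact: rtrans_smooth.
Qed.

(** The function f (x * y), with x and y read in charts. *)
Definition mul_coord (a b : chart R n G) f (z : 'rV[R]_n * 'rV[R]_n) : R :=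
  f (bwd a z.1 * bwd b z.2)%g.

Definition cod2 (a b : chart R n G) : set ('rV[R]_n * 'rV[R]_n) :=
  [set z | cod a z.1 /\ cod b z.2].

Lemma open_cod2 a b : open (cod2 a b).
Proof.
have -> : cod2 a b = (fst @^-1` cod a) `&` (snd @^-1` cod b) by [].
apply: openI.
  apply: (@open_comp _ _ (@fst 'rV[R]_n 'rV[R]_n) (cod a)) => [z _|].
    exact: cvg_fst.
  exact: (@open_cod _ _ _ a).
apply: (@open_comp _ _ (@snd 'rV[R]_n 'rV[R]_n) (cod b)) => [z _|].
  exact: cvg_snd.
exact: (@open_cod _ _ _ b).
Qed.

Lemma smooth_mul_coord a b f k : atlas L a -> atlas L b -> smooth_fun L f ->
  Ck k (cod2 a b) (mul_coord a b f).
Proof.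
move=> La Lb sf; apply: Ck_local => z [az bz].
have [c Lc cz] := atlas_cover L (bwd a z.1 * bwd b z.2)%g.
pose U := [set z : 'rV[R]_n * 'rV[R]_n |
   [/\ cod a z.1, cod b z.2 & dom c (bwd a z.1 * bwd b z.2)%g]].
have oU : open U.
  have -> : U = cod2 a b `&`
      (fun z : 'rV[R]_n * 'rV[R]_n => bwd a z.1 * bwd b z.2)%g @^-1` dom c.
    by apply/seteqP; split=> y /=; [case=> ? ? ?|case=> -[? ?] ?].
  apply: open_preimage_in; [exact: open_cod2|exact: open_dom|].
  move=> y /set_mem[ay by_].
  apply: (@continuous_comp _ _ _ (fun z : 'rV[R]_n * 'rV[R]_n => (bwd a z.1, bwd b z.2))
                    (fun z : G * G => (z.1 * z.2)%g)); last exact: mulg_continuous.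
  apply: cvg_pair.
    apply: (@continuous_comp _ _ _ fst (bwd a)); first exact: cvg_fst.
    by apply: bwd_continuous; exact/mem_set.
  apply: (@continuous_comp _ _ _ snd (bwd b)); first exact: cvg_snd.
  by apply: bwd_continuous; exact/mem_set.
exists U => //.
pose H := (fun z : 'rV[R]_n * 'rV[R]_n => fwd c (bwd a z.1 * bwd b z.2)%g).
apply: (Ck_ext (f := (f \o bwd c) \o H) oU).
  by move=> y [_ _ cy]; rewrite /= /H fwdK.
apply: (Ck_comp oU _ (sf c Lc k) (mul_smooth La Lb Lc k)).
by move=> y [_ _ cy]; exact: fwd_cod.
Qed.

(** Differentiating f (x * p) at x = 1 along v is, in charts, a directional
    derivative of the smooth function [mul_coord], restricted to a slice. *)
Lemma smooth_rinv v f : tangent L 1%g v -> smooth_fun L f ->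
  smooth_fun L (fun p => v (f \o rtrans p)).
Proof.
move=> tv sf b Lb k; have [c Lc c1] := atlas_cover L (1%g : G).
have [w wP] := tangent_chart tv Lc c1.
have [_ /(_ (w, 0)) CF] := smooth_mul_coord k.+1 Lc Lb sf.
have -> : (fun p => v (f \o rtrans p)) \o bwd b =
          (fun y => 'D_(w, 0) (mul_coord c b f) (fwd c 1%g, y)).
  apply/funext => y; rewrite /= wP.
    exact: (derive_slicel (mul_coord c b f)).
  by apply: smooth_fun_comp => //; exact: rtrans_smooth.
by apply: Ck_slicer CF => y by_; split=> //=; exact: fwd_cod.
Qed.

Lemma smooth_linv v f : tangent L 1%g v -> smooth_fun L f ->
  smooth_fun L (fun p => v (f \o ltrans p)).
Proof.
move=> tv sf b Lb k; have [c Lc c1] := atlas_cover L (1%g : G).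
have [w wP] := tangent_chart tv Lc c1.
have [_ /(_ (0, w)) CF] := smooth_mul_coord k.+1 Lb Lc sf.
have -> : (fun p => v (f \o ltrans p)) \o bwd b =
          (fun y => 'D_(0, w) (mul_coord b c f) (y, fwd c 1%g)).
  apply/funext => y; rewrite /= wP.
    exact: (derive_slicer (mul_coord b c f)).
  by apply: smooth_fun_comp => //; exact: ltrans_smooth.
by apply: Ck_slicel CF => y by_; split=> //=; exact: fwd_cod.
Qed.

(** Left and right translations commute, hence so do the left-invariant and
    the right-invariant vector fields: at the identity, both composites are
    mixed second derivatives of (x, y) |-> f (x * y). *)
Lemma invariant_fields_commute v w f :
  tangent L 1%g v -> tangent L 1%g w -> smooth_fun L f ->
  v (fun q => w (f \o rtrans q)) = w (fun q => v (f \o ltrans q)).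
Proof.
move=> tv tw sf; have [c Lc c1] := atlas_cover L (1%g : G).
have [v' vP] := tangent_chart tv Lc c1; have [w' wP] := tangent_chart tw Lc c1.
rewrite vP; last exact: smooth_rinv.
rewrite [RHS]wP; last exact: smooth_linv.
set x0 := fwd c 1%g; pose F := mul_coord c c f.
have -> : (fun q => w (f \o rtrans q)) \o bwd c = (fun y => 'D_(w', 0) F (x0, y)).
  apply/funext => y; rewrite /= wP.
    exact: (derive_slicel (mul_coord c c f)).
  by apply: smooth_fun_comp => //; exact: rtrans_smooth.
have -> : (fun q => v (f \o ltrans q)) \o bwd c = (fun y => 'D_(0, v') F (y, x0)).
  apply/funext => y; rewrite /= vP.
    exact: (derive_slicer (mul_coord c c f)).
  by apply: smooth_fun_comp => //; exact: ltrans_smooth.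
rewrite (derive_slicer (fun z => 'D_(w', 0) F z)).
rewrite (derive_slicel (fun z => 'D_(0, v') F z)).
apply: (mixed_derivatives _ _ (@open_cod2 c c)); last exact: smooth_mul_coord.
by split; exact: fwd_cod.
Qed.

(** The right-invariant field with value v at the identity. *)
Definition rinv v : field R G := fun p f => v (f \o rtrans p).

Lemma rinv_vector_field v : tangent L 1%g v -> vector_field L (rinv v).
Proof.
move=> tv; split=> [p|f sf]; last exact: smooth_rinv.
have := tangent_push (rtrans_smooth p) (@smooth_rtransE p) tv.
by rewrite {1}/rtrans mul1g.
Qed.

Lemma rinv_push v g p : push (rtrans g) (rinv v p) = rinv v (p * g)%g.
Proof.
apply/funext => f; rewrite /push /rinv; congr v; apply/funext => x.
by rewrite /= /rtrans mulgA.
Qed.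

Lemma rinv1 v : rinv v 1%g = v.
Proof.
apply/funext => f; rewrite /rinv; congr v; apply/funext => x.
by rewrite /= /rtrans mulg1.
Qed.

Lemma lie_algebraE (X : field R G) p f : lie_algebra L X ->
  X p f = X 1%g (f \o ltrans p).
Proof. by move=> [_ /(_ p 1%g)]; rewrite mulg1 => <-. Qed.

End Translations.

(** * Vector fields, connections and curvature *)
Section VectorFields.
Local Open Scope classical_set_scope.
Local Open Scope ring_scope.
Context {R : realType} {n : nat} {M : topologicalType}.
Variable S : smooth_structure R n M.
Implicit Types (f g : M -> R) (p : M) (X Y Z : field R M).

Lemma fieldDE X Y p f : (X + Y) p f = X p f + Y p f. Proof. by []. Qed.
Lemma fieldNE X p f : (- X) p f = - X p f. Proof. by []. Qed.
Lemma fscaleE f X p g : fscale f X p g = f p * X p g. Proof. by []. Qed.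
Lemma fieldZE (a : R) X p f : (a *: X) p f = a * X p f. Proof. by []. Qed.
Lemma field_sumE m (X : 'I_m -> field R M) p f :
  (\sum_(i < m) X i) p f = \sum_(i < m) X i p f.
Proof. by rewrite !fct_sumE. Qed.
Lemma tangent_sumE m (v : 'I_m -> (M -> R) -> R) f :
  (\sum_(i < m) v i) f = \sum_(i < m) v i f.
Proof. by rewrite !fct_sumE. Qed.
Lemma field_sum_at m (X : 'I_m -> field R M) p :
  (\sum_(i < m) X i) p = \sum_(i < m) X i p.
Proof. by rewrite !fct_sumE. Qed.
Definition fieldE := (fieldDE, fieldNE, fscaleE, fieldZE, field_sumE).

Lemma vf_tangent X p : vector_field S X -> tangent S p (X p).
Proof. by move=> [tX _]; exact: tX. Qed.

Lemma vf_smooth X f : vector_field S X -> smooth_fun S f -> smooth_fun S (X ^~ f).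
Proof. by move=> [_ sX]; exact: sX. Qed.

Lemma vf_nonsmooth X p f : vector_field S X -> ~ smooth_fun S f -> X p f = 0.
Proof. by move=> /(@vf_tangent _ p)[+ _]; apply. Qed.

Lemma vf0 : vector_field S (0 : field R M).
Proof. by split=> [p|f _]; [exact: tangent0|exact: smooth_cst]. Qed.

Lemma vfD X Y : vector_field S X -> vector_field S Y -> vector_field S (X + Y).
Proof.
move=> vX vY; split=> [p|f sf]; first by apply: tangentD; exact: vf_tangent.
by apply: smoothD; exact: vf_smooth.
Qed.

Lemma vf_fscale f X : smooth_fun S f -> vector_field S X -> vector_field S (fscale f X).
Proof.
move=> sf vX; split=> [p|g sg]; first by apply: tangentZ; exact: vf_tangent.
by apply: smoothM => //; exact: vf_smooth.
Qed.

Lemma vfN X : vector_field S X -> vector_field S (- X).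
Proof.
move=> vX; have -> : - X = fscale (fun=> -1) X.
  by apply/funext => p; apply/funext => f; rewrite !fieldE mulN1r.
by apply: vf_fscale => //; exact: smooth_cst.
Qed.

Lemma vf_sum m (X : 'I_m -> field R M) : (forall i, vector_field S (X i)) ->
  vector_field S (\sum_i X i).
Proof. by move=> vX; apply: big_ind => //; [exact: vf0|exact: vfD]. Qed.

Lemma bracketDl X X' Y : vector_field S X -> vector_field S X' -> vector_field S Y ->
  bracket (X + X') Y = bracket X Y + bracket X' Y.
Proof.
move=> vX vX' vY; apply/funext => p; apply/funext => g; rewrite !fieldE /bracket.
have [sg|ng] := pselect (smooth_fun S g).
  rewrite fieldDE (tangent_addf (vf_tangent p vY)); last 2 first.
  - exact: vf_smooth.
  - exact: vf_smooth.
  by ring.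
under [X in Y p X]eq_fun do rewrite fieldDE !vf_nonsmooth// addr0.
under [X in _ = _ - Y p X + _]eq_fun do rewrite vf_nonsmooth//.
under [X in _ = _ + (_ - Y p X)]eq_fun do rewrite vf_nonsmooth//.
by rewrite (tangent_cst _ (vf_tangent p vY)) fieldDE; ring.
Qed.

Lemma bracket_fscalel f X Y :
  smooth_fun S f -> vector_field S X -> vector_field S Y ->
  bracket (fscale f X) Y =
  fscale f (bracket X Y) + fscale (fun p => -1 * Y p f) X.
Proof.
move=> sf vX vY; apply/funext => p; apply/funext => g; rewrite !fieldE /bracket.
have [sg|ng] := pselect (smooth_fun S g).
  rewrite !fieldE (tangent_mulf (vf_tangent p vY) sf); last exact: vf_smooth.
  by ring.
under [X in Y p X]eq_fun do rewrite fscaleE vf_nonsmooth// mulr0.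
under [X in _ = f p * (_ - Y p X) + _]eq_fun do rewrite vf_nonsmooth//.
rewrite (tangent_cst _ (vf_tangent p vY)) fieldE (vf_nonsmooth p vX ng).
by ring.
Qed.

Section LeviCivita.
Variables (m : metric R M) (nabla : field R M -> field R M -> field R M).
Hypothesis LC : levi_civita S m nabla.

(** Freeness of torsion exhibits the bracket as a difference of two vector
    fields. *)
Lemma bracket_vf X Y : vector_field S X -> vector_field S Y ->
  vector_field S (bracket X Y).
Proof.
move=> vX vY; rewrite -(nabla_torsion_free LC vX vY).
by apply: vfD; [|apply: vfN]; exact: (nabla_field LC).
Qed.

Lemma nabla0l Y : vector_field S Y -> nabla 0 Y = 0.
Proof.
move=> vY; have := nabla_addl LC vf0 vf0 vY.
by rewrite addr0 -[LHS]addr0 => /addrI <-.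
Qed.

Lemma nabla0r X : vector_field S X -> nabla X 0 = 0.
Proof.
move=> vX; have := nabla_addr LC vX vf0 vf0.
by rewrite addr0 -[LHS]addr0 => /addrI <-.
Qed.

Lemma nabla_suml k (X : 'I_k -> field R M) Y :
  (forall i, vector_field S (X i)) -> vector_field S Y ->
  nabla (\sum_i X i) Y = \sum_i nabla (X i) Y.
Proof.
move=> vX vY; elim: k X vX => [|k IH] X vX; first by rewrite !big_ord0 nabla0l.
rewrite !big_ord_recr /= (nabla_addl LC) ?IH//; exact: vf_sum.
Qed.

Lemma nabla_sumr k X (Y : 'I_k -> field R M) :
  vector_field S X -> (forall i, vector_field S (Y i)) ->
  nabla X (\sum_i Y i) = \sum_i nabla X (Y i).
Proof.
move=> vX vY; elim: k Y vY => [|k IH] Y vY; first by rewrite !big_ord0 nabla0r.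
rewrite !big_ord_recr /= (nabla_addr LC) ?IH//; exact: vf_sum.
Qed.

Lemma nabla_cstr (a : R) X Y : vector_field S X -> vector_field S Y ->
  nabla X (fscale (fun=> a) Y) = fscale (fun=> a) (nabla X Y).
Proof.
move=> vX vY; rewrite (nabla_leibniz LC (@smooth_cst _ _ _ S a) vX vY).
apply/funext => p; apply/funext => g.
by rewrite !fieldE (tangent_cst _ (vf_tangent p vX)) mul0r add0r.
Qed.

Lemma curvature_vf X Y Z :
  vector_field S X -> vector_field S Y -> vector_field S Z ->
  vector_field S (curvature nabla X Y Z).
Proof.
move=> vX vY vZ; rewrite /curvature.
have vn := nabla_field LC.
apply: vfD; last by apply: vfN; apply: (vn _ _) => //; exact: bracket_vf.
by apply: vfD; [|apply: vfN]; apply: (vn _ _) => //; apply: (vn _ _).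
Qed.

Lemma curvatureDl X X' Y Z : vector_field S X -> vector_field S X' ->
  vector_field S Y -> vector_field S Z ->
  curvature nabla (X + X') Y Z = curvature nabla X Y Z + curvature nabla X' Y Z.
Proof.
move=> vX vX' vY vZ; rewrite /curvature bracketDl//.
have vn := nabla_field LC; have vb := bracket_vf.
have vYZ := vn _ _ vY vZ; have vXZ := vn _ _ vX vZ; have vX'Z := vn _ _ vX' vZ.
have vB := vb _ _ vX vY; have vB' := vb _ _ vX' vY.
rewrite (nabla_addl LC vX vX' vYZ) (nabla_addl LC vX vX' vZ) (nabla_addl LC vB vB' vZ).
rewrite (nabla_addr LC)//.
by apply/funext => p; apply/funext => g; rewrite !fieldE; ring.
Qed.

(** The derivative of f in the Leibniz rule cancels against the one in the bracket
    of f X with Y. *)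
Lemma curvature_fscalel f X Y Z : smooth_fun S f -> vector_field S X ->
  vector_field S Y -> vector_field S Z ->
  curvature nabla (fscale f X) Y Z = fscale f (curvature nabla X Y Z).
Proof.
move=> sf vX vY vZ; rewrite /curvature bracket_fscalel//.
have vn := nabla_field LC; have vb := bracket_vf.
have vYZ := vn _ _ vY vZ; have vXZ := vn _ _ vX vZ; have vXY := vb _ _ vX vY.
have sYf : smooth_fun S (fun p => -1 * Y p f).
  by apply: smoothZ; exact: vf_smooth.
have v1 := vf_fscale sf vXY; have v2 := vf_fscale sYf vX.
rewrite (nabla_addl LC v1 v2 vZ).
rewrite !(nabla_scalel LC)// (nabla_leibniz LC)//.
by apply/funext => p; apply/funext => g; rewrite !fieldE; ring.
Qed.

Lemma curvature_suml k (f : 'I_k -> M -> R) (X : 'I_k -> field R M) Y Z :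
  (forall i, smooth_fun S (f i)) -> (forall i, vector_field S (X i)) ->
  vector_field S Y -> vector_field S Z ->
  curvature nabla (\sum_i fscale (f i) (X i)) Y Z =
  \sum_i fscale (f i) (curvature nabla (X i) Y Z).
Proof.
move=> sf vX vY vZ; elim: k f X sf vX => [|k IH] f X sf vX.
  rewrite !big_ord0; have := curvature_fscalel (@smooth_cst _ _ _ S 0) vf0 vY vZ.
  have Z0 W : fscale (fun=> 0 : R) W = 0 :> field R M.
    by apply/funext => p; apply/funext => g; rewrite fieldE mul0r.
  by rewrite !Z0.
rewrite !big_ord_recr /= curvatureDl ?IH ?curvature_fscalel//.
- by apply: vf_sum => i; exact: vf_fscale.
- exact: vf_fscale.
Qed.

End LeviCivita.
End VectorFields.

(** * Two facts of linear algebra *)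
Section LinearAlgebra.
Local Open Scope ring_scope.
Context {R : realType} {n : nat}.

(** The hypothesis says that A D is a left inverse of the transpose of A, where
    D is the diagonal matrix of the weights x; for square matrices it is then
    also a right inverse. *)
Lemma dual_orthonormal (x : 'I_n -> R) (A : 'M[R]_n) : (forall i, 0 < x i) ->
  (forall k l, \sum_i A k i * x i * A l i = (k == l)%:R) ->
  forall i j, \sum_k A k i * A k j = (x i)^-1 * (i == j)%:R.
Proof.
move=> x_gt0 oA i j; pose B := \matrix_(k, i) (A k i * x i).
have BA : B *m A^T = 1%:M.
  apply/matrixP => k l; rewrite !mxE -oA; apply: eq_bigr => q _.
  by rewrite !mxE.
have /matrixP/(_ j i) := mulmx1C BA; rewrite !mxE => E.
apply: (mulfI (lt0r_neq0 (x_gt0 i))); rewrite mulrA divff ?lt0r_neq0// mul1r.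
rewrite eq_sym -E mulr_sumr; apply: eq_bigr => q _; rewrite !mxE; ring.
Qed.

(** Polarization at the vector of ones, which is interior to the cone of
    positive vectors. *)
Lemma quadratic_form_eq0 (q : 'I_n -> 'I_n -> R) :
  (forall k l, q k l = q l k) ->
  (forall y : 'I_n -> R, (forall i, 0 < y i) ->
     \sum_k \sum_l q k l * (y k * y l) = 0) ->
  forall k l, q k l = 0.
Proof.
move=> sq q0 s t.
pose d (s k : 'I_n) : R := (k == s)%:R.
have d0 u k : 0 <= d u k by rewrite /d ler0n.
pose S (y : 'I_n -> R) := \sum_k \sum_l q k l * (y k * y l).
have pick u v : \sum_k \sum_l q k l * (d u k * d v l) = q u v.
  rewrite (bigD1 u)//= (bigD1 v)//= /d !eqxx !mulr1 big1 ?addr0 => [|l lv].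
    rewrite big1 ?addr0// => k ku; rewrite big1// => l _.
    by rewrite (negbTE ku) mul0r mulr0.
  by rewrite (negbTE lv) !mulr0.
have : q s t + q t s = S (fun k => 1 + d s k + d t k) - S (fun k => 1 + d s k)
    - (S (fun k => 1 + d t k) - S (fun=> 1)).
  rewrite -{1}(pick s t) -(pick t s) /S -!sumrB -big_split; apply: eq_bigr => k _ /=.
  rewrite -!sumrB -big_split; apply: eq_bigr => l _ /=.
  by ring.
have p1 u k : 0 < 1 + d u k by rewrite ltr_pwDl.
rewrite [S _](q0 (fun k => 1 + d s k + d t k)); last by move=> k; rewrite ltr_wpDr.
rewrite [S _](q0 (fun k => 1 + d s k)) // [S _](q0 (fun k => 1 + d t k)) //.
rewrite [S _](q0 (fun=> 1)) //.
by rewrite (sq t s); lra.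
Qed.

End LinearAlgebra.

(** * The structure constants of a frame orthonormal for a bi-invariant metric *)
Section Frame.
Local Open Scope classical_set_scope.
Local Open Scope ring_scope.
Context {R : realType} {n : nat} {G : topologicalGroupType}.
Variables (L : lie_group R n G) (Q : metric R G) (e : 'I_n -> field R G).
Hypothesis rQ : riemannian L Q.
Hypothesis biQ : bi_invariant L Q.
Hypothesis lie_e : forall i, lie_algebra L (e i).
Hypothesis oe : orthonormal_at Q 1%g e.
Implicit Types (p : G) (X Y Z : field R G) (f : G -> R).

Lemma frame_vf i : vector_field L (e i).
Proof. by have [] := lie_e i. Qed.

Lemma frame_tangent i p : tangent L p (e i p).
Proof. exact/vf_tangent/frame_vf. Qed.

Lemma left_invariant_const (m : metric R G) X Y p :
  left_invariant L m -> lie_algebra L X -> lie_algebra L Y ->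
  inner m X Y p = inner m X Y 1%g.
Proof.
move=> lm [vX lX] [vY lY]; rewrite /inner -(lm p 1%g); last 2 first.
- exact: vf_tangent.
- exact: vf_tangent.
by rewrite lX lY mulg1.
Qed.

Lemma frame_orthonormal p : orthonormal_at Q p e.
Proof. by move=> k l; rewrite (left_invariant_const _ (proj1 biQ))// oe. Qed.

Lemma tangent_expansion p v : tangent L p v -> v = \sum_k Q p v (e k p) *: e k p.
Proof.
apply: (orthonormal_expansion rQ) => [k|k l]; first exact: frame_tangent.
exact: frame_orthonormal.
Qed.

Definition coord X k : G -> R := inner Q X (e k).

Lemma coord_smooth X k : vector_field L X -> smooth_fun L (coord X k).
Proof. by move=> vX; apply: (metric_smooth rQ) => //; exact: frame_vf. Qed.

Lemma vf_expansion X : vector_field L X -> X = \sum_k fscale (coord X k) (e k).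
Proof.
move=> vX; apply/funext => p; rewrite {1}(tangent_expansion (vf_tangent p vX)).
by rewrite field_sum_at.
Qed.

Lemma coord_sum (a : 'I_n -> G -> R) k p :
  coord (\sum_i fscale (a i) (e i)) k p = a k p.
Proof.
rewrite /coord /inner field_sum_at (metric_sumZl rQ)//; last 2 first.
- by move=> i; exact: frame_tangent.
- exact: frame_tangent.
rewrite (bigD1 k)//= [Q _ _ _]frame_orthonormal eqxx mulr1 big1 ?addr0// => i ik.
by rewrite [Q _ _ _]frame_orthonormal (negbTE ik) mulr0.
Qed.

Let rframe k : field R G := rinv (e k 1%g).
Let Ad_coef j k : G -> R := inner Q (e j) (rframe k).

Lemma rframe_vf k : vector_field L (rframe k).
Proof. exact/rinv_vector_field/frame_tangent. Qed.

Lemma rframe_orthonormal p k l : Q p (rframe k p) (rframe l p) = (k == l)%:R.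
Proof.
transitivity (Q (1 * p)%g (push (rtrans p) (rframe k 1%g))
                          (push (rtrans p) (rframe l 1%g))).
  by rewrite !rinv_push mul1g.
rewrite (proj2 biQ) /rframe ?rinv1; last 2 first.
- exact: frame_tangent.
- exact: frame_tangent.
exact: oe.
Qed.

Lemma frame_rexpansion j p f : e j p f = \sum_k Ad_coef j k p * rframe k p f.
Proof.
rewrite {1}(orthonormal_expansion rQ (E := fun k => rframe k p) _ _ (frame_tangent j p)).
- by rewrite tangent_sumE.
- by move=> k; exact/vf_tangent/rframe_vf.
- exact: rframe_orthonormal.
Qed.

Lemma Ad_coef_smooth j k : smooth_fun L (Ad_coef j k).
Proof. by apply: (metric_smooth rQ); [exact: frame_vf|exact: rframe_vf]. Qed.

Lemma Ad_coef1 j k : Ad_coef j k 1%g = (j == k)%:R.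
Proof. by rewrite /Ad_coef /inner /rframe rinv1 [Q _ _ _]oe. Qed.

(** [Ad_coef] is the matrix of Ad in the basis e, as a function on G; its derivative
    at the identity is the matrix of ad. That these numbers are the structure
    constants is [bracket_frame]. *)
Definition struct_cst i j k : R := e i 1%g (Ad_coef j k).

(** In [e i, e j] = sum_k [e i, Ad_coef j k rframe k], the terms
    Ad_coef j k [e i, rframe k] vanish since the left-invariant e i commutes with
    the right-invariant fields. *)
Lemma bracket_frame1 i j f :
  bracket (e i) (e j) 1%g f = \sum_k struct_cst i j k * e k 1%g f.
Proof.
have [sf|nf] := pselect (smooth_fun L f); last first.
  rewrite /bracket; under [X in e i _ X]eq_fun do rewrite (vf_nonsmooth _ (frame_vf j))//.
  under [X in e j _ X]eq_fun do rewrite (vf_nonsmooth _ (frame_vf i))//.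
  rewrite !(tangent_cst _ (frame_tangent _ _)) subr0 big1// => k _.
  by rewrite (vf_nonsmooth _ (frame_vf k))// mulr0.
rewrite /bracket (_ : (fun q => e j q f) =
                      fun q => \sum_k Ad_coef j k q * rframe k q f); last first.
  by apply/funext => q; exact: frame_rexpansion.
have sr k : smooth_fun L (fun q => rframe k q f).
  by apply: vf_smooth => //; exact: rframe_vf.
rewrite (tangent_sumf (f := fun k q => Ad_coef j k q * rframe k q f)
                      (frame_tangent i 1%g)).
  rewrite [e j 1%g _]frame_rexpansion -sumrB; apply: eq_bigr => k _.
  rewrite (tangent_mulf (frame_tangent i 1%g))//; last exact: Ad_coef_smooth.
  rewrite /rframe !rinv1 -/(struct_cst i j k) -addrA -[RHS]addr0.
  congr (_ + _); apply/eqP; rewrite subr_eq0; apply/eqP; congr (_ * _).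
  under [X in e k _ X]eq_fun do rewrite (lie_algebraE _ _ (lie_e i)).
  exact: (invariant_fields_commute (frame_tangent i 1%g) (frame_tangent k 1%g) sf).
by move=> k; apply: smoothM => //; exact: Ad_coef_smooth.
Qed.

(** Both sides are left-invariant, so the case of the identity suffices. *)
Lemma bracket_frame i j :
  bracket (e i) (e j) = \sum_k fscale (fun=> struct_cst i j k) (e k).
Proof.
apply/funext => p; apply/funext => f.
have trans k l : e k p (e l ^~ f) = e k 1%g (e l ^~ (f \o ltrans p)).
  rewrite (lie_algebraE _ _ (lie_e k)); congr (e k 1%g _); apply/funext => q /=.
  by rewrite /ltrans -(proj2 (lie_e l) p q).
rewrite /bracket !trans -[LHS]/(bracket (e i) (e j) 1%g (f \o ltrans p)).
rewrite bracket_frame1 field_sumE; apply: eq_bigr => k _.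
by rewrite fscaleE (lie_algebraE p f (lie_e k)).
Qed.

Lemma struct_cstC i j k : struct_cst i j k = - struct_cst j i k.
Proof.
have E l m p : coord (bracket (e l) (e m)) k p = struct_cst l m k.
  by rewrite bracket_frame coord_sum.
rewrite -(E i j 1%g) -(E j i 1%g).
have -> : bracket (e i) (e j) = - bracket (e j) (e i).
  by apply/funext => p; apply/funext => f; rewrite fieldNE /bracket opprB.
rewrite /coord /inner -scaleN1r (metricZl rQ) ?mulN1r//; last exact: frame_tangent.
rewrite bracket_frame; apply: vf_tangent; apply: vf_sum => l.
by apply: vf_fscale; [exact: smooth_cst|exact: frame_vf].
Qed.

(** The matrix [Ad_coef] is orthogonal at every point, because both frames are
    Q-orthonormal; hence its derivative at the identity is skew-symmetric. *)
Lemma struct_cst_skew i j k : struct_cst i j k = - struct_cst i k j.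
Proof.
have orth : (fun q => \sum_l Ad_coef j l q * Ad_coef k l q) = fun=> (j == k)%:R.
  apply/funext => q; rewrite -(frame_orthonormal q j k) /inner.
  rewrite (orthonormal_expansion rQ (E := fun l => rframe l q) _ _ (frame_tangent k q)).
  - rewrite (metric_sumZr rQ)//; first by apply: eq_bigr => l _; rewrite mulrC.
      by move=> l; exact/vf_tangent/rframe_vf.
    exact: frame_tangent.
  - by move=> l; exact/vf_tangent/rframe_vf.
  - exact: rframe_orthonormal.
have := congr1 (e i 1%g) orth; rewrite (tangent_cst _ (frame_tangent _ _)).
rewrite (tangent_sumf (f := fun l q => Ad_coef j l q * Ad_coef k l q)
                      (frame_tangent i 1%g)); last first.
  by move=> l; apply: smoothM; exact: Ad_coef_smooth.
under eq_bigr do rewrite (tangent_mulf (frame_tangent i 1%g)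
  (Ad_coef_smooth _ _) (Ad_coef_smooth _ _)) !Ad_coef1.
rewrite big_split /= (bigD1 k)//= eqxx mulr1 big1 ?addr0; last first.
  by move=> l lk; rewrite eq_sym (negbTE lk) mulr0.
rewrite (bigD1 j)//= eqxx mul1r big1 ?addr0; last first.
  by move=> l lj; rewrite eq_sym (negbTE lj) mul0r.
by move/eqP; rewrite addr_eq0 => /eqP.
Qed.

Lemma struct_cst_cycle i j k : struct_cst i j k = struct_cst j k i.
Proof. by rewrite struct_cstC struct_cst_skew opprK. Qed.

(** By cyclic symmetry the product is that of the coefficients of e i and e j in
    the bracket of e l and e k. *)
Lemma niceP : nice e <->
  (forall i j l k, i != j -> struct_cst i l k * struct_cst j l k = 0).
Proof.
split=> [ne i j l k ij|zs i j].
  have [k' [b bE]] := ne l k.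
  have E i' : struct_cst l k i' = b * (k' == i')%:R.
    rewrite -(frame_orthonormal 1%g k' i') /inner -(metricZl rQ); last 2 first.
    - exact: frame_tangent.
    - exact: frame_tangent.
    by rewrite -(coord_sum (fun m _ => struct_cst l k m) i' 1%g) -bracket_frame bE.
  rewrite !(struct_cst_cycle _ l k) !E; have [->|_] := eqVneq k' i.
    by rewrite (negbTE ij) !mulr0.
  by rewrite mulr0 mul0r.
have [[k ck]|/forallNP zc] := pselect (exists k, struct_cst i j k != 0).
  exists k, (struct_cst i j k); rewrite bracket_frame (bigD1 k)//= big1 ?addr0// => l lk.
  have := zs _ _ i j lk; rewrite (struct_cst_cycle l) (struct_cst_cycle k).
  move=> /eqP; rewrite mulf_eq0 (negbTE ck) orbF.
  by move=> /eqP ->; apply/funext => p; apply/funext => f; rewrite fscaleE mul0r.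
exists i, 0; rewrite bracket_frame scale0r big1// => k _.
apply/funext => p; apply/funext => f; rewrite fscaleE.
by have /negP := zc k; rewrite negbK => /eqP ->; rewrite mul0r.
Qed.

(** * Ricci curvature of a left-invariant metric diagonal in the frame *)
Definition christoffel (x : 'I_n -> R) i j k : R :=
  struct_cst i j k * (x k - x i + x j) / (2 * x k).

Section DiagonalMetric.
Variables (m : metric R G) (x : 'I_n -> R).
Hypothesis rm : riemannian L m.
Hypothesis x_gt0 : forall i, 0 < x i.
Hypothesis me : forall p i j, m p (e i p) (e j p) = x i * (i == j)%:R.
Variable nabla : field R G -> field R G -> field R G.
Hypothesis LC : levi_civita L m nabla.

Lemma metric_frame p v k : tangent L p v -> m p v (e k p) = x k * Q p v (e k p).
Proof.
move=> tv; rewrite {1}(tangent_expansion tv) (metric_sumZl rm); last 2 first.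
- by move=> i; exact: frame_tangent.
- exact: frame_tangent.
rewrite (bigD1 k)//= me eqxx mulr1 mulrC big1 ?addr0// => i ik.
by rewrite me (negbTE ik) !mulr0.
Qed.

(** Koszul's formula for constant inner products: m (nabla (e i) (e j)) (e k) is
    determined by its antisymmetry in j, k (compatibility with m) and by its
    antisymmetrization in i, j (freeness of torsion). *)
Lemma nabla_frame i j :
  nabla (e i) (e j) = \sum_k fscale (fun=> christoffel x i j k) (e k).
Proof.
have vD i' j' : vector_field L (nabla (e i') (e j')).
  by apply: (nabla_field LC); exact: frame_vf.
rewrite [LHS]vf_expansion//; apply: eq_bigr => k _; congr fscale.
apply/funext => p; pose g i j k := m p (nabla (e i) (e j) p) (e k p).
have skew i' j' k' : g i' j' k' = - g i' k' j'.
  have := congr1 (@^~ p) (nabla_metric LC (frame_vf i') (frame_vf j') (frame_vf k')).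
  rewrite /= (_ : inner m (e j') (e k') = fun=> x j' * (j' == k')%:R); last first.
    by apply/funext => q; rewrite /inner me.
  rewrite (tangent_cst _ (frame_tangent i' p)) => /esym/eqP.
  rewrite addr_eq0 => /eqP E; rewrite /g [LHS]E; congr (- _).
  by apply: (metricC rm); [exact: frame_tangent|exact: vf_tangent].
have torsion i' j' k' : g i' j' k' - g j' i' k' = struct_cst i' j' k' * x k'.
  have := nabla_torsion_free LC (frame_vf i') (frame_vf j').
  move=> /(congr1 (fun X : field R G => m p (X p) (e k' p))).
  rewrite bracket_frame field_sum_at (metric_sumZl rm); last 2 first.
  - by move=> l; exact: frame_tangent.
  - exact: frame_tangent.
  rewrite (bigD1 k')//= me eqxx mulr1 big1 ?addr0 => [<-|l lk]; last first.
    by rewrite me (negbTE lk) !mulr0.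
  have -> : (nabla (e i') (e j') - nabla (e j') (e i')) p =
    -1 *: nabla (e j') (e i') p + nabla (e i') (e j') p by rewrite scaleN1r addrC.
  rewrite (metricZDl rm) ?mulN1r 1?addrC//; last exact: frame_tangent.
  - exact: vf_tangent.
  - exact: vf_tangent.
have E : 2 * g i j k = struct_cst i j k * (x k - x i + x j).
  have := skew i j k; have := torsion i k j; have := skew k i j.
  have := torsion k j i; have := skew j k i; have := torsion i j k.
  rewrite (struct_cst_skew i k j) (struct_cstC k j i).
  by rewrite (struct_cst_cycle j k i) (struct_cst_cycle k i j); lra.
have := metric_frame k (vf_tangent p (vD i j)); rewrite -/(g i j k) => gE.
rewrite /coord /inner /christoffel -E gE; have := lt0r_neq0 (x_gt0 k) => xk.
by field.
Qed.

(** The coefficient on e k of R (e l, e i) (e j). *)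
Definition curv_coef l i j k : R := \sum_q
  (christoffel x i j q * christoffel x l q k
   - christoffel x l j q * christoffel x i q k - struct_cst l i q * christoffel x q j k).

Lemma curvature_frame l i j : curvature nabla (e l) (e i) (e j) =
  \sum_k fscale (fun=> curv_coef l i j k) (e k).
Proof.
have vf := frame_vf.
have vsum (b : 'I_n -> R) k : vector_field L (fscale (fun=> b k) (e k)).
  by apply: vf_fscale => //; exact: smooth_cst.
have nn i' j' k' : nabla (e i') (nabla (e j') (e k')) =
    \sum_q fscale (fun=> christoffel x j' k' q) (nabla (e i') (e q)).
  rewrite [in LHS](nabla_frame j' k') (nabla_sumr LC)//.
  by apply: eq_bigr => q _; rewrite (nabla_cstr LC).
have nb : nabla (bracket (e l) (e i)) (e j) =
    \sum_q fscale (fun=> struct_cst l i q) (nabla (e q) (e j)).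
  rewrite bracket_frame (nabla_suml LC)//; apply: eq_bigr => q _.
  by rewrite (nabla_scalel LC)//; exact: smooth_cst.
rewrite /curvature !nn nb; apply/funext => p; apply/funext => f.
rewrite !fieldE; under eq_bigr do rewrite fscaleE nabla_frame field_sumE mulr_sumr.
rewrite exchange_big /=.
under [X in _ - X]eq_bigr do rewrite fscaleE nabla_frame field_sumE mulr_sumr.
rewrite [X in _ - X]exchange_big /=.
under [X in _ - X - _]eq_bigr do rewrite fscaleE nabla_frame field_sumE mulr_sumr.
rewrite [X in _ - X - _]exchange_big /= -!sumrB; apply: eq_bigr => k _.
rewrite fscaleE mulr_suml -!sumrB; apply: eq_bigr => q _.
by rewrite !fscaleE; ring.
Qed.

(** By tensoriality the trace can be moved from the family E, whose derivatives
    are arbitrary, to the frame; the weight x l of e l cancels against the one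
    given by [dual_orthonormal]. *)
Lemma ricci_frame (E : 'I_n -> field R G) i j :
  (forall k, vector_field L (E k)) -> orthonormal_at m 1%g E ->
  ricci m nabla E (e i) (e j) 1%g = \sum_l curv_coef l i j l.
Proof.
move=> vE oE; have vf := frame_vf.
pose A := \matrix_(k, l) coord (E k) l 1%g.
have EE k : E k 1%g = \sum_l A k l *: e l 1%g.
  rewrite {1}(vf_expansion (vE k)) field_sum_at.
  by apply: eq_bigr => l _; rewrite mxE.
have te k : tangent L 1%g (e k 1%g) by exact: frame_tangent.
have tc l : tangent L 1%g (curvature nabla (e l) (e i) (e j) 1%g).
  by apply: vf_tangent; exact: (curvature_vf LC).
have oA k l : \sum_i A k i * x i * A l i = (k == l)%:R.
  rewrite -oE /inner !EE (metric_sumZl rm)//; last first.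
    by apply: tangent_sum => q; exact: tangentZ.
  apply: eq_bigr => q _; rewrite (metric_sumZr rm)//.
  rewrite (bigD1 q)//= me eqxx mulr1 big1 ?addr0 => [|q' q'q].
    by rewrite -mulrA [x q * _]mulrC.
  by rewrite me eq_sym (negbTE q'q) !mulr0.
have mc l l' : m 1%g (curvature nabla (e l) (e i) (e j) 1%g) (e l' 1%g) =
    x l' * curv_coef l i j l'.
  rewrite metric_frame// curvature_frame.
  by rewrite -(coord_sum (fun k _ => curv_coef l i j k) l' 1%g).
transitivity (\sum_k \sum_l \sum_l' (A k l * A k l') * (x l' * curv_coef l i j l')).
  apply: eq_bigr => k _; rewrite /inner.
  have -> : curvature nabla (E k) (e i) (e j) 1%g =
      \sum_l A k l *: curvature nabla (e l) (e i) (e j) 1%g.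
    rewrite {1}(vf_expansion (vE k)) (curvature_suml LC)// => [|l].
      by rewrite field_sum_at; apply: eq_bigr => l _; rewrite mxE.
    exact: coord_smooth.
  rewrite (metric_sumZl rm)//; last exact: vf_tangent.
  apply: eq_bigr => l _; rewrite EE (metric_sumZr rm)// mulr_sumr.
  by apply: eq_bigr => l' _; rewrite mc mulrA.
rewrite exchange_big /=; apply: eq_bigr => l _; rewrite exchange_big /=.
under eq_bigr do rewrite -mulr_suml (dual_orthonormal x_gt0 oA).
rewrite (bigD1 l)//= eqxx mulr1 big1 ?addr0 => [|l' l'l].
  by rewrite mulrA mulVf ?mul1r// lt0r_neq0.
by rewrite eq_sym (negbTE l'l) mulr0 mul0r.
Qed.

(** The factor c i l q * c j l q is symmetric in l and q, so the other factor may
    be symmetrized, which reduces its numerator to x i x j - (x l - x q)^2. *)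
Lemma ricci_coef i j : \sum_l curv_coef l i j l =
  \sum_l \sum_q struct_cst i l q * struct_cst j l q *
    ((x i * x j - (x l - x q) ^+ 2) / (4 * x l * x q)).
Proof.
have c0 k l : struct_cst k l l = 0.
  by have := struct_cst_skew k l l; lra.
(* P is the other factor as it comes out of the curvature. *)
pose P l q := (x l - x q + x j) / (2 * x l)
   - (x q - x l + x j) * (x l - x i + x q) / (4 * x q * x l).
transitivity (\sum_l \sum_q struct_cst i l q * struct_cst j l q * P l q).
  apply: eq_bigr => l _; apply: eq_bigr => q _; rewrite /christoffel.
  rewrite (struct_cst_cycle l q l) c0 (struct_cstC l j q) (struct_cst_skew i q l).
  rewrite (struct_cstC l i q) (struct_cst_cycle q j l) /P.
  have := lt0r_neq0 (x_gt0 l); have := lt0r_neq0 (x_gt0 q) => xq xl.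
  by field; rewrite xq xl.
have sym : \sum_l \sum_q struct_cst i l q * struct_cst j l q * P l q =
    \sum_l \sum_q struct_cst i l q * struct_cst j l q * P q l.
  rewrite exchange_big; apply: eq_bigr => l _; apply: eq_bigr => q _.
  by rewrite (struct_cst_skew i) (struct_cst_skew j) mulrNN.
rewrite -[LHS](mulKf (x := 2)) ?pnatr_eq0// mulr2n mulrDl mul1r {2}sym.
rewrite -big_split /= mulr_sumr; apply: eq_bigr => l _.
rewrite -big_split /= mulr_sumr; apply: eq_bigr => q _; rewrite /P.
have := lt0r_neq0 (x_gt0 l); have := lt0r_neq0 (x_gt0 q) => xq xl.
by field; rewrite xq xl.
Qed.

End DiagonalMetric.

(** * Existence of diagonal metrics and of their Levi-Civita connections *)
Section DiagonalConstruction.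
Variable x : 'I_n -> R.
Hypothesis x_gt0 : forall i, 0 < x i.

Definition diag_metric : metric R G :=
  fun p v w => \sum_i x i * (Q p v (e i p) * Q p w (e i p)).

Lemma diag_metric_frame p i j : diag_metric p (e i p) (e j p) = x i * (i == j)%:R.
Proof.
rewrite /diag_metric (bigD1 i)//= ![Q _ _ _]frame_orthonormal eqxx mul1r.
rewrite big1 ?addr0 1?eq_sym// => k ki.
by rewrite ![Q _ _ _]frame_orthonormal eq_sym (negbTE ki) mul0r mulr0.
Qed.

Lemma diag_metric_riemannian : riemannian L diag_metric.
Proof.
have ft := frame_tangent; split.
- by move=> p v w tv tw; apply: eq_bigr => i _; rewrite [_ * Q p w _]mulrC.
- move=> p b u v w tu tv tw; rewrite /diag_metric mulr_sumr -big_split/=.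
  by apply: eq_bigr => i _; rewrite (metricZDl rQ)//; ring.
- move=> p v tv v0; rewrite lt_neqAle; apply/andP; split; last first.
    by apply: sumr_ge0 => i _; rewrite mulr_ge0 ?(ltW (x_gt0 i))// -expr2 sqr_ge0.
  apply: contra_neq v0 => /esym s0; rewrite (tangent_expansion tv) big1// => i _.
  have := psumr_eq0P _ s0 => /(_ _ i isT) => z.
  have /eqP : x i * (Q p v (e i p) * Q p v (e i p)) = 0.
    by apply: z => k _; rewrite mulr_ge0 ?(ltW (x_gt0 k))// -expr2 sqr_ge0.
  rewrite mulf_eq0 (gt_eqF (x_gt0 i)) /= mulf_eq0 orbb => /eqP ->.
  by rewrite scale0r.
- move=> X Y vX vY; apply: smooth_sum => i; apply: smoothZ; apply: smoothM.
    exact: (coord_smooth i vX).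
  exact: (coord_smooth i vY).
Qed.

Lemma diag_metric_left_invariant : left_invariant L diag_metric.
Proof.
move=> g p v w tv tw; apply: eq_bigr => i _.
by rewrite -(proj2 (lie_e i) g p) !(proj1 biQ)//; exact: frame_tangent.
Qed.

Lemma coordD X Y k p : vector_field L X -> vector_field L Y ->
  coord (X + Y) k p = coord X k p + coord Y k p.
Proof.
move=> vX vY; apply: (metricDl rQ); [exact: vf_tangent|exact: vf_tangent|].
exact: frame_tangent.
Qed.

Lemma coord_fscale f X k p : vector_field L X ->
  coord (fscale f X) k p = f p * coord X k p.
Proof.
by move=> vX; apply: (metricZl rQ); [exact: vf_tangent|exact: frame_tangent].
Qed.

(** The covariant derivative of sum_j b_j e j along sum_i a_i e i, as dictated by
    the Leibniz rule and the Christoffel symbols of the frame. *)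
Definition diag_connection_coef X Y k p : R := X p (coord Y k) +
  \sum_i \sum_j coord X i p * coord Y j p * christoffel x i j k.

Definition diag_connection X Y : field R G :=
  \sum_k fscale (diag_connection_coef X Y k) (e k).

Lemma diag_connection_coef_smooth X Y k : vector_field L X -> vector_field L Y ->
  smooth_fun L (diag_connection_coef X Y k).
Proof.
move=> vX vY; apply: smoothD; first by apply: vf_smooth => //; exact: coord_smooth.
apply: smooth_sum => i; apply: smooth_sum => j; apply: smoothM; last exact: smooth_cst.
by apply: smoothM; exact: coord_smooth.
Qed.

Lemma bracket_expansion X Y : vector_field L X -> vector_field L Y ->
  bracket X Y = \sum_k fscale (fun p => X p (coord Y k) - Y p (coord X k) +
    \sum_i \sum_j coord X i p * coord Y j p * struct_cst i j k) (e k).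
Proof.
move=> vX vY; apply/funext => p; apply/funext => g; rewrite field_sumE.
have [sg|ng] := pselect (smooth_fun L g); last first.
  rewrite /bracket; under [F in X p F]eq_fun do rewrite (vf_nonsmooth _ vY)//.
  under [F in Y p F]eq_fun do rewrite (vf_nonsmooth _ vX)//.
  rewrite (tangent_cst _ (vf_tangent p vX)) (tangent_cst _ (vf_tangent p vY)).
  rewrite subr0 big1// => k _.
  by rewrite fscaleE (vf_nonsmooth _ (frame_vf k))// mulr0.
have XE Z q h : vector_field L Z -> Z q h = \sum_i coord Z i q * e i q h.
  by move=> vZ; rewrite {1}(vf_expansion vZ) field_sumE.
have se i : smooth_fun L (e i ^~ g) by apply: vf_smooth => //; exact: frame_vf.
have XY X' Y' : vector_field L X' -> vector_field L Y' -> X' p (Y' ^~ g) =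
    \sum_j (X' p (coord Y' j) * e j p g +
            \sum_i coord X' i p * coord Y' j p * e i p (e j ^~ g)).
  move=> vX' vY'.
  rewrite (_ : Y' ^~ g = fun q => \sum_j coord Y' j q * e j q g); last first.
    by apply/funext => q; exact: XE.
  rewrite (tangent_sumf (f := fun j q => coord Y' j q * e j q g) (vf_tangent p vX')).
    apply: eq_bigr => j _.
    rewrite (tangent_mulf (vf_tangent p vX') (coord_smooth j vY') (se j)).
    rewrite [X' p (e j ^~ g)]XE// mulr_sumr; congr (_ + _).
    by apply: eq_bigr => i _; ring.
  by move=> j; apply: smoothM => //; exact: coord_smooth.
rewrite /bracket (XY X Y)// (XY Y X)// !big_split /=.
under [RHS]eq_bigr do rewrite fscaleE !mulrDl mulNr mulr_suml.
rewrite !big_split /= sumrN opprD addrACA; congr (_ + _).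
rewrite [X in X - _]exchange_big /= -sumrB [RHS]exchange_big; apply: eq_bigr => i _ /=.
under [RHS]eq_bigr do rewrite mulr_suml.
rewrite [RHS]exchange_big -sumrB; apply: eq_bigr => j _ /=.
have := congr1 (fun Z : field R G => Z p g) (bracket_frame i j).
rewrite field_sumE /bracket => E.
rewrite [coord Y j p * coord X i p]mulrC -mulrBr E mulr_sumr.
by apply: eq_bigr => k _; rewrite fscaleE mulrA.
Qed.

Lemma christoffel_torsion i j k :
  christoffel x i j k - christoffel x j i k = struct_cst i j k.
Proof.
rewrite /christoffel (struct_cstC j i); have := lt0r_neq0 (x_gt0 k) => xk.
by field.
Qed.

Lemma christoffel_metric i j k :
  x k * christoffel x i j k = - (x j * christoffel x i k j).
Proof.
rewrite /christoffel (struct_cst_skew i k); have := lt0r_neq0 (x_gt0 k) => xk.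
by have := lt0r_neq0 (x_gt0 j) => xj; field; rewrite xk xj.
Qed.

(** In the frame, freeness of torsion amounts to [christoffel_torsion], and
    compatibility with the metric to [christoffel_metric]. *)
Lemma diag_connection_levi_civita : levi_civita L diag_metric diag_connection.
Proof.
have ft := frame_tangent; have vf := frame_vf.
split.
- move=> X Y vX vY; apply: vf_sum => k; apply: vf_fscale => //.
  exact: diag_connection_coef_smooth.
- move=> X X' Y vX vX' vY; rewrite /diag_connection -big_split; apply: eq_bigr => k _ /=.
  apply/funext => p; apply/funext => g; rewrite !fieldE -mulrDl; congr (_ * _).
  rewrite /diag_connection_coef fieldDE addrACA -big_split; congr (_ + _).
  apply: eq_bigr => i _ /=; rewrite -big_split; apply: eq_bigr => j _ /=.
  by rewrite coordD// -!mulrDl.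
- move=> f X Y sf vX vY; apply/funext => p; apply/funext => g.
  rewrite /diag_connection !fieldE mulr_sumr; apply: eq_bigr => k _.
  rewrite !fieldE mulrA; congr (_ * _).
  rewrite /diag_connection_coef fieldE mulrDr; congr (_ + _); rewrite mulr_sumr.
  apply: eq_bigr => i _; rewrite mulr_sumr; apply: eq_bigr => j _.
  by rewrite coord_fscale// !mulrA.
- move=> X Y Y' vX vY vY'; rewrite /diag_connection -big_split; apply: eq_bigr => k _ /=.
  apply/funext => p; apply/funext => g; rewrite !fieldE -mulrDl; congr (_ * _).
  rewrite /diag_connection_coef addrACA -big_split; congr (_ + _).
    rewrite -(tangent_addf (vf_tangent p vX)); last 2 first.
    + exact: coord_smooth.
    + exact: coord_smooth.
    by congr (X p _); apply/funext => q; rewrite coordD.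
  apply: eq_bigr => i _ /=; rewrite -big_split; apply: eq_bigr => j _ /=.
  by rewrite coordD// -!mulrDl -mulrDr.
- move=> f X Y sf vX vY; rewrite [in fscale (X ^~ f) Y](vf_expansion vY).
  apply/funext => p; apply/funext => g.
  rewrite /diag_connection !fieldE !mulr_sumr -big_split.
  apply: eq_bigr => k _ /=; rewrite !fieldE !mulrA -mulrDl; congr (_ * _).
  rewrite /diag_connection_coef (_ : coord (fscale f Y) k = fun q => f q * coord Y k q).
    rewrite (tangent_mulf (vf_tangent p vX) sf); last exact: coord_smooth.
    rewrite mulrDr addrA; congr (_ + _); rewrite mulr_sumr.
    apply: eq_bigr => i _; rewrite mulr_sumr; apply: eq_bigr => j _.
    by rewrite coord_fscale//; ring.
  by apply/funext => q; rewrite coord_fscale.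
- move=> X Y vX vY; rewrite bracket_expansion// /diag_connection.
  apply/funext => p; apply/funext => g; rewrite !fieldE -sumrB.
  apply: eq_bigr => k _; rewrite !fieldE -mulrBl; congr (_ * _).
  rewrite /diag_connection_coef opprD addrACA; congr (_ + _).
  rewrite [X in _ - X]exchange_big -sumrB; apply: eq_bigr => i _ /=.
  rewrite -sumrB; apply: eq_bigr => j _.
  by rewrite -(christoffel_torsion i j k); ring.
- move=> X Y Z vX vY vZ.
  have connC X' Y' k p :
      Q p (diag_connection X' Y' p) (e k p) = diag_connection_coef X' Y' k p.
    exact: coord_sum.
  apply/funext => p; rewrite fctE /inner /diag_metric.
  have sYZ k : smooth_fun L (fun q => coord Y k q * coord Z k q).
    by apply: smoothM; exact: coord_smooth.
  rewrite (tangent_sumf (f := fun k q => x k * (coord Y k q * coord Z k q))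
    (vf_tangent p vX)); last by move=> k; exact: smoothZ.
  rewrite -[RHS]big_split /=.
  under eq_bigr => k _ do rewrite (tangent_scalef _ (vf_tangent p vX) (sYZ k))
    (tangent_mulf (vf_tangent p vX) (coord_smooth k vY) (coord_smooth k vZ)).
  under [RHS]eq_bigr do rewrite !connC /diag_connection_coef.
  apply/eqP; rewrite eq_sym -subr_eq0 -sumrB; apply/eqP.
  (* A and B are what the Christoffel symbols contribute to the two terms of the
     product rule; they cancel by the antisymmetry in the last two indices. *)
  pose A := \sum_(k < n) \sum_(i < n) \sum_(j < n)
    coord X i p * coord Y j p * coord Z k p * (x k * christoffel x i j k).
  pose B := \sum_(k < n) \sum_(i < n) \sum_(j < n)
    coord X i p * coord Z j p * coord Y k p * (x k * christoffel x i j k).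
  have AB : A + B = 0.
    rewrite /A /B exchange_big [X in _ + X]exchange_big -big_split big1//= => i _.
    rewrite [X in _ + X]exchange_big -big_split big1//= => k _.
    rewrite -big_split big1//= => j _.
    by rewrite (christoffel_metric i j k); ring.
  rewrite -[RHS]AB /A /B -big_split; apply: eq_bigr => k _ /=.
  rewrite [X in _ = X + _](_ : _ = x k * coord Z k p *
    \sum_(i < n) \sum_(j < n) coord X i p * coord Y j p * christoffel x i j k); last first.
    rewrite mulr_sumr; apply: eq_bigr => i _; rewrite mulr_sumr.
    by apply: eq_bigr => j _; ring.
  rewrite [X in _ = _ + X](_ : _ = x k * coord Y k p *
    \sum_(i < n) \sum_(j < n) coord X i p * coord Z j p * christoffel x i j k); last first.
    rewrite mulr_sumr; apply: eq_bigr => i _; rewrite mulr_sumr.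
    by apply: eq_bigr => j _; ring.
  by rewrite -[Q p (Z p) _]/(coord Z k p) -[Q p (Y p) _]/(coord Y k p); ring.
Qed.

Lemma normalized_frame_orthonormal :
  orthonormal_at diag_metric 1%g (fun k => fscale (fun=> (Num.sqrt (x k))^-1) (e k)).
Proof.
move=> k l; have ft := frame_tangent; have rd := diag_metric_riemannian.
rewrite /inner (metricZl rd)//; last exact: tangentZ.
rewrite (metricC rd)//; last exact: tangentZ.
rewrite (metricZl rd)// diag_metric_frame eq_sym.
have [->|_] := eqVneq k l; last by rewrite !mulr0.
rewrite mulr1 mulrA -invfM -expr2 sqr_sqrtr ?ltW// mulVf//.
exact: lt0r_neq0.
Qed.

End DiagonalConstruction.

(** The converse compares the Ricci curvatures of the metrics of weights x and
    x', where x' is x with x i doubled. *)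
Lemma stably_ricci_diagonalP : stably_ricci_diagonal L e <->
  (forall i j k l, i != j -> struct_cst i k l * struct_cst j k l = 0).
Proof.
split=> [sd i j k l ij|z m rm lm dm nabla E LC vE oE i j ij]; last first.
  pose x i := m 1%g (e i 1%g) (e i 1%g).
  have me p i' j' : m p (e i' p) (e j' p) = x i' * (i' == j')%:R.
    rewrite [LHS](left_invariant_const p lm (lie_e i') (lie_e j')).
    by have [->|ij'] := eqVneq i' j'; [rewrite mulr1|rewrite mulr0 dm].
  have x_gt0 i' : 0 < x i'.
    apply: (metric_posdef rm); first exact: frame_tangent.
    apply/eqP => e0; have := frame_orthonormal 1%g i' i'.
    rewrite /inner e0 (metric0l rQ) ?eqxx => [/esym/eqP|]; last exact: tangent0.
    by rewrite oner_eq0.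
  rewrite (ricci_frame rm x_gt0 me LC)// (ricci_coef x_gt0).
  by rewrite big1// => k _; rewrite big1// => l _; rewrite z// mul0r.
pose W (x : 'I_n -> R) := \sum_k \sum_l struct_cst i k l * struct_cst j k l *
  ((x i * x j - (x k - x l) ^+ 2) / (4 * x k * x l)).
have ric x : (forall i, 0 < x i) -> W x = 0.
  move=> x_gt0; rewrite /W -(ricci_coef x_gt0).
  have rd := diag_metric_riemannian x_gt0.
  have vE k' : vector_field L (fscale (fun=> (Num.sqrt (x k'))^-1) (e k')).
    by apply: vf_fscale; [exact: smooth_cst|exact: frame_vf].
  have oE := normalized_frame_orthonormal x_gt0.
  have lc := diag_connection_levi_civita x_gt0.
  rewrite -(ricci_frame rd x_gt0 (diag_metric_frame x) lc i j vE oE).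
  apply: (sd _ rd (diag_metric_left_invariant x) _ _ _ lc vE oE _ _ ij).
  by move=> i' j' ij'; rewrite /inner diag_metric_frame (negbTE ij') mulr0.
apply: (quadratic_form_eq0 (q := fun k l => struct_cst i k l * struct_cst j k l)).
  by move=> k' l'; rewrite (struct_cst_skew i) (struct_cst_skew j) mulrNN.
move=> y y_gt0.
have struct_cst0 i' k' : struct_cst i' i' k' = 0 by have := struct_cstC i' i' k'; lra.
(* The polynomial in y arises from the denominators x k * x l. *)
pose x k' := (y k')^-1.
pose x' k' := if k' == i then 2 * x i else x k'.
have x_gt0 k' : 0 < x k' by rewrite invr_gt0.
have x'_gt0 k' : 0 < x' k' by rewrite /x'; case: ifP => _ //; rewrite mulr_gt0.
have ne0 : x i * x j / 4 != 0.
  by rewrite !mulf_neq0 ?invr_eq0 ?pnatr_eq0// lt0r_neq0.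
apply: (mulfI ne0); rewrite mulr0.
transitivity (W x' - W x); last by rewrite !ric// subrr.
rewrite /W mulr_sumr -sumrB; apply: eq_bigr => k' _.
rewrite mulr_sumr -sumrB; apply: eq_bigr => l' _.
rewrite /x' eqxx [j == i]eq_sym (negbTE ij).
have [->|_] := eqVneq k' i; first by rewrite struct_cst0 !mul0r mulr0 subrr.
have [->|_] := eqVneq l' i.
  by rewrite (struct_cst_skew i k' i) (struct_cst0 i) oppr0 !mul0r mulr0 subrr.
have yk := lt0r_neq0 (y_gt0 k'); have yl := lt0r_neq0 (y_gt0 l').
have yi := lt0r_neq0 (y_gt0 i); have yj := lt0r_neq0 (y_gt0 j).
by rewrite /x; field; rewrite yk yl yi yj.
Qed.

End Frame.

Theorem corollary2 (R : realType) (n : nat) (G : topologicalGroupType)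
    (L : lie_group R n G) (Q : metric R G) (e : 'I_n -> field R G) :
  compact [set: G]%classic ->
  riemannian L Q -> bi_invariant L Q ->
  lie_basis L e -> orthonormal_at Q 1%g e ->
  stably_ricci_diagonal L e <-> nice e.
Proof.
move=> _ rQ biQ [le _] oe.
by rewrite (stably_ricci_diagonalP rQ biQ le oe) (niceP rQ biQ le oe).
Qed.
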